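(* Let $f=h+\overline{g}$ be a sense-preserving harmonic mapping in $\mathbb{D}$. Then, for each $\varepsilon\in\overline{\mathbb{D}}$, either $\|P_{h+\varepsilon g}\|=\|P_f\|=\infty$ or both $\|P_{h+\varepsilon g}\|$ and $\|P_f\|$ are finite. If $\|P_f\|<\infty$, then the inequality $$\big|\,\|P_{h+\varepsilon g}\|-\|P_f\|\,\big|\leq 1$$ holds for each $\varepsilon\in\overline{\mathbb{D}}$. In particular, $$\big|\,\|P_{h}\|-\|P_f\|\,\big|\leq 1.$$ The constant $1$ is sharp in the two estimates.
   Context: $\mathbb{D}=\{z\in\mathbb{C}:|z|<1\}$ and $\overline{\mathbb{D}}$ is its closure. A harmonic mapping in $\mathbb{D}$ is a complex-valued function $f$ with $\Delta f=0$; it has a canonical representation $f=h+\overline{g}$ with $h,g$ analytic in $\mathbb{D}$ and $g(0)=0$. Its Jacobian is $J_f=|h'|^2-|g'|^2$, and $f$ is sense-preserving if $J_f>0$ in $\mathbb{D}$, equivalently $|h'|>|g'|$ in $\mathbb{D}$. Its dilatation is $\omega=g'/h'$. The pre-Schwarzian derivative of a sense-preserving harmonic mapping $f=h+\overline g$ is $$P_f=(\log J_f)_z=\frac{h''\overline{h'}-g''\overline{g'}}{|h'|^2-|g'|^2}=\frac{h''}{h'}-\frac{\overline{\omega}\,\omega'}{1-|\omega|^2},$$ and its pre-Schwarzian norm is $\|P_f\|=\sup_{z\in\mathbb{D}}(1-|z|^2)|P_f(z)|\in[0,\infty]$. For a locally univalent analytic function $\varphi$ (the case $\omega\equiv 0$),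 $P_\varphi=\varphi''/\varphi'$ and $\|P_\varphi\|$ is defined by the same formula. (For $f$ sense-preserving, $h+\varepsilon g$ is a locally univalent analytic function for each $\varepsilon\in\overline{\mathbb{D}}$.) *)

(* Defs.v *)
From Stdlib Require Import Reals.
From Coquelicot Require Import Coquelicot.
Open Scope R_scope.

(* All functions are total on C, but only their values on the open unit disk
   matter: every notion below is local and is imposed or evaluated there. *)
Definition in_disk (z : C) : Prop := Cmod z < 1.

Definition in_closed_disk (z : C) : Prop := Cmod z <= 1.

Definition analytic_in_disk (h : C -> C) : Prop :=
  forall z : C, in_disk z -> @ex_derive C_AbsRing C_NormedModule h z.

(* C^2 with vanishing Laplacian.  Regularity has to be required explicitly
   because partial_derive is total: [ex_diff_n u 2 x y] says that the partial
   derivatives of order at most 2 exist and are continuous at (x, y). *)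
Definition harmonic_real (u : R -> R -> R) : Prop :=
  forall x y : R, in_disk (x, y) ->
    ex_diff_n u 2 x y /\
    partial_derive 2 0 u x y + partial_derive 0 2 u x y = 0.

Definition harmonic_in_disk (f : C -> C) : Prop :=
  harmonic_real (fun x y => fst (f (x, y))) /\
  harmonic_real (fun x y => snd (f (x, y))).

Definition canonical_representation (f h g : C -> C) : Prop :=
  analytic_in_disk h /\ analytic_in_disk g /\ g (RtoC 0) = RtoC 0 /\
  forall z : C, in_disk z -> f z = Cplus (h z) (Cconj (g z)).

(* In the following, f = h + conj g is given by its canonical pair (h, g). *)
Definition jacobian (h g : C -> C) (z : C) : R :=
  Cmod (C_derive h z) ^ 2 - Cmod (C_derive g z) ^ 2.

Definition sense_preserving_harmonic (f h g : C -> C) : Prop :=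
  harmonic_in_disk f /\ canonical_representation f h g /\
  forall z : C, in_disk z -> 0 < jacobian h g z.

Definition pre_schwarzian_harmonic (h g : C -> C) (z : C) : C :=
  Cdiv
    (Cminus
       (Cmult (C_derive (C_derive h) z) (Cconj (C_derive h z)))
       (Cmult (C_derive (C_derive g) z) (Cconj (C_derive g z))))
    (RtoC (jacobian h g z)).

Definition pre_schwarzian_analytic (phi : C -> C) (z : C) : C :=
  Cdiv (C_derive (C_derive phi) z) (C_derive phi z).

Definition hyperbolic_sup (P : C -> C) : Rbar :=
  Lub_Rbar (fun r : R =>
    exists z : C, in_disk z /\ r = (1 - Cmod z ^ 2) * Cmod (P z)).

Definition norm_harmonic (h g : C -> C) : Rbar :=
  hyperbolic_sup (pre_schwarzian_harmonic h g).

Definition norm_analytic (phi : C -> C) : Rbar :=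
  hyperbolic_sup (pre_schwarzian_analytic phi).

Definition shear (eps : C) (h g : C -> C) : C -> C :=
  fun z => Cplus (h z) (Cmult eps (g z)).

(* Distance of two elements of [0, +oo]; it is only used when at least one of
   them is finite (Rbar_minus p_infty p_infty would be 0). *)
Definition Rbar_gap (a b : Rbar) : Rbar := Rbar_abs (Rbar_minus a b).

(* Main.v *)
Require Import Defs.
From Stdlib Require Import Reals Lra FunctionalExtensionality.
From Coquelicot Require Import Coquelicot.
Open Scope R_scope.

(** The two pre-Schwarzian derivatives differ pointwise by at most the hyperbolic
density.  Writing H = h', G = g' and J = |H|^2 - |G|^2,

  P_{h+eps g} - P_f = (G' H - G H') / J * (eps conj H + conj G) / (H + eps G).

The last factor has modulus at most 1 when |eps| <= 1, because
|H + eps G|^2 - |eps conj H + conj G|^2 = (1 - |eps|^2) J.  The first factor is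
omega' / (1 - |omega|^2) up to a unimodular number, where omega = G / H maps the
disk into itself, so the Schwarz-Pick inequality bounds it by 1 / (1 - |z|^2).
Multiplying by 1 - |z|^2 and taking suprema gives both the dichotomy and the
estimate ([pre_schwarzian_difference], [Schwarz_Pick_quotient],
[hyperbolic_sup_gap]).

The analytic input is obtained from two elementary sources.  Analyticity of h and
g only means that complex derivatives exist; that h' and g' are again
differentiable, with continuous derivatives, is read off from f being of class
C^2, through the Cauchy-Riemann equations for h + g and -i (h - g), whose real
parts are Re f and Im f ([C1_holomorphic_derivatives]).  For functions F with a
continuous complex derivative, the estimate |F'(0)| <= 1 when |F| <= 1 follows
from the circle means K(t) = int Re (F(t e^{i th}) e^{-i th}) d th: they satisfy
t K'(t) = K(t), hence K(t) = K'(0) t, where K'(0) = 2 pi Re F'(0)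
([Cauchy_estimate]).  Disk automorphisms then carry the estimate to every point.

For sharpness take |d| < 1, h' = 1 - d z and g' = z - conj d, so that omega is a
disk automorphism and J = (1 - |d|^2) (1 - |z|^2); then (1 - |z|^2) |P_f| = |z|
and the norm of P_f is 1.  If |eps| < 1, the choice d = eps makes h' + eps g'
constant and the other norm is 0; if |eps| = 1, the choice d = 0 gives
h' + eps g' = 1 + eps z and the other norm is 2. *)

Local Notation is_Cderive :=
  (@is_derive C_AbsRing (AbsRing_NormedModule C_AbsRing)).
Local Notation Ccontinuous :=
  (@continuous (AbsRing_UniformSpace C_AbsRing)
     (AbsRing_UniformSpace C_AbsRing)).

(** * Complex derivatives and continuity *)

(** The two normed-module structures on [C] carry the same norm but different
(equivalent) uniform structures.  The algebraic one supports the product and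
chain rules; the other one is the one that [C_derive] refers to. *)
Lemma is_Cderive_C_NormedModule (F : C -> C) (z l : C) :
  is_Cderive F z l <-> @is_derive C_AbsRing C_NormedModule F z l.
Proof.
  split; intros [[H1 H2 H3] H4]; split; try exact H4; now constructor.
Qed.

Lemma is_Cderive_unique (F : C -> C) (z l : C) :
  is_Cderive F z l -> C_derive F z = l.
Proof. now intros H; apply is_C_derive_unique, is_Cderive_C_NormedModule. Qed.

Lemma is_Cderive_ext_loc (F G : C -> C) (z l : C) (d : R) :
  0 < d -> (forall w, Cmod (w - z) < d -> F w = G w) ->
  is_Cderive F z l -> is_Cderive G z l.
Proof.
  intros Hd HFG. apply is_derive_ext_loc.
  exists (mkposreal d Hd). intros w Hw. now apply HFG.
Qed.

Lemma is_Cderive_eps (F : C -> C) (z l : C) :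
  is_Cderive F z l <->
  forall eps : posreal, exists d : posreal, forall w, Cmod (w - z) < d ->
    Cmod (F w - F z - (w - z) * l) <= eps * Cmod (w - z).
Proof.
  split.
  - intros [_ H] eps.
    destruct (H z (fun P HP => HP) eps) as [d Hd].
    exists d; intros w Hw; exact (Hd w Hw).
  - intros H; split.
    + apply is_linear_scal_l.
    + intros x Hx.
      rewrite <- (is_filter_lim_locally_unique _ _ Hx).
      intros eps. destruct (H eps) as [d Hd].
      exists d; intros w Hw; exact (Hd w Hw).
Qed.

Lemma Ccontinuous_eps (F : C -> C) (z : C) :
  Ccontinuous F z <->
  forall eps : posreal, exists d : posreal, forall w, Cmod (w - z) < d ->
    Cmod (F w - F z) < eps.
Proof.
  split.
  - intros H eps.
    destruct (H (fun y => Cmod (y - F z) < eps)) as [d Hd].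
    + exists eps; intros y Hy; exact Hy.
    + exists d; intros w Hw; exact (Hd w Hw).
  - intros H P [eps HP]. destruct (H eps) as [d Hd].
    exists d; intros w Hw. apply HP, Hd, Hw.
Qed.

Lemma is_Cderive_continuous (F : C -> C) (z l : C) :
  is_Cderive F z l -> Ccontinuous F z.
Proof.
  intros H. apply (@ex_derive_continuous C_AbsRing (AbsRing_NormedModule C_AbsRing)).
  now exists l.
Qed.

Lemma is_Cderive_const (c z : C) : is_Cderive (fun _ => c) z (RtoC 0).
Proof. exact (@is_derive_const C_AbsRing (AbsRing_NormedModule C_AbsRing) c z). Qed.

Lemma is_Cderive_id (z : C) : is_Cderive (fun w => w) z (RtoC 1).
Proof. exact (@is_derive_id C_AbsRing z). Qed.

Lemma is_Cderive_affine (c0 c1 z : C) :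
  is_Cderive (fun w => c0 + c1 * w)%C z c1.
Proof.
  apply is_Cderive_eps. intros eps. exists (mkposreal 1 Rlt_0_1). intros w _.
  replace (c0 + c1 * w - (c0 + c1 * z) - (w - z) * c1)%C with (RtoC 0) by ring.
  rewrite Cmod_0. apply Rmult_le_pos; [apply Rlt_le, cond_pos | apply Cmod_ge_0].
Qed.

Lemma is_Cderive_plus (F G : C -> C) (z l m : C) :
  is_Cderive F z l -> is_Cderive G z m ->
  is_Cderive (fun w => F w + G w)%C z (l + m)%C.
Proof.
  exact (@is_derive_plus C_AbsRing (AbsRing_NormedModule C_AbsRing) F G z l m).
Qed.

Lemma is_Cderive_minus (F G : C -> C) (z l m : C) :
  is_Cderive F z l -> is_Cderive G z m ->
  is_Cderive (fun w => F w - G w)%C z (l - m)%C.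
Proof.
  exact (@is_derive_minus C_AbsRing (AbsRing_NormedModule C_AbsRing) F G z l m).
Qed.

Lemma is_Cderive_mult (F G : C -> C) (z l m : C) :
  is_Cderive F z l -> is_Cderive G z m ->
  is_Cderive (fun w => F w * G w)%C z (l * G z + F z * m)%C.
Proof. intros HF HG. exact (@is_derive_mult C_AbsRing F G z l m HF HG Cmult_comm). Qed.

Lemma is_Cderive_scal (c : C) (F : C -> C) (z l : C) :
  is_Cderive F z l -> is_Cderive (fun w => c * F w)%C z (c * l)%C.
Proof.
  intros HF. replace (c * l)%C with (RtoC 0 * F z + c * l)%C by ring.
  apply (is_Cderive_mult (fun _ => c)); [apply is_Cderive_const | exact HF].
Qed.

Lemma is_Cderive_comp (F G : C -> C) (z l m : C) :
  is_Cderive F (G z) l -> is_Cderive G z m ->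
  is_Cderive (fun w => F (G w)) z (m * l)%C.
Proof.
  exact (@is_derive_comp C_AbsRing (AbsRing_NormedModule C_AbsRing) F G z l m).
Qed.

Lemma is_Cderive_inv (z : C) :
  z <> RtoC 0 -> is_Cderive Cinv z (- / (z * z))%C.
Proof.
  intros Hz. apply is_Cderive_eps. intros eps.
  assert (Hm : 0 < Cmod z) by now apply Cmod_gt_0.
  assert (He := cond_pos eps).
  set (m := Cmod z) in *.
  assert (Hm3 : 0 < m / 2 * (m * m))
    by (repeat apply Rmult_lt_0_compat; lra).
  assert (Hd : 0 < Rmin (m / 2) (eps * (m / 2 * (m * m)))).
  { apply Rmin_pos; [lra | now apply Rmult_lt_0_compat]. }
  exists (mkposreal _ Hd); simpl; intros w Hw.
  assert (Hw1 := Rlt_le_trans _ _ _ Hw (Rmin_l _ _)).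
  assert (Hw2 := Rlt_le_trans _ _ _ Hw (Rmin_r _ _)).
  assert (Hmw : m / 2 < Cmod w).
  { assert (H := Cmod_triangle w (z - w)%C).
    replace (w + (z - w))%C with z in H by ring.
    replace (z - w)%C with (- (w - z))%C in H by ring.
    rewrite Cmod_opp in H. fold m in H. lra. }
  assert (Hw0 : w <> RtoC 0).
  { intros E. rewrite E, Cmod_0 in Hmw. lra. }
  replace (/ w - / z - (w - z) * - / (z * z))%C
    with ((w - z) * ((w - z) / (w * (z * z))))%C by (field; now split).
  rewrite Cmod_mult, (Rmult_comm eps).
  apply Rmult_le_compat_l; [apply Cmod_ge_0|].
  rewrite Cmod_div by (repeat apply Cmult_neq_0; assumption).
  rewrite !Cmod_mult; fold m.
  apply Rle_div_l; [apply Rmult_lt_0_compat; nra|].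
  apply Rlt_le, (Rlt_le_trans _ _ _ Hw2).
  apply Rmult_le_compat_l; [lra|]. apply Rmult_le_compat_r; nra.
Qed.

Lemma is_Cderive_div (F G : C -> C) (z l m : C) :
  is_Cderive F z l -> is_Cderive G z m -> G z <> RtoC 0 ->
  is_Cderive (fun w => F w / G w)%C z ((l * G z - F z * m) / (G z * G z))%C.
Proof.
  intros HF HG H0.
  replace ((l * G z - F z * m) / (G z * G z))%C
    with (l * / G z + F z * (m * - / (G z * G z)))%C by (field; exact H0).
  apply (is_Cderive_mult F (fun w => / G w)%C); [exact HF|].
  apply (is_Cderive_comp Cinv G); [now apply is_Cderive_inv | exact HG].
Qed.

Lemma Ccontinuous_plus (F G : C -> C) (z : C) :
  Ccontinuous F z -> Ccontinuous G z -> Ccontinuous (fun w => F w + G w)%C z.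
Proof.
  exact (@continuous_plus (AbsRing_UniformSpace C_AbsRing) C_AbsRing
    (AbsRing_NormedModule C_AbsRing) F G z).
Qed.

Lemma Ccontinuous_minus (F G : C -> C) (z : C) :
  Ccontinuous F z -> Ccontinuous G z -> Ccontinuous (fun w => F w - G w)%C z.
Proof.
  exact (@continuous_minus (AbsRing_UniformSpace C_AbsRing) C_AbsRing
    (AbsRing_NormedModule C_AbsRing) F G z).
Qed.

Lemma Ccontinuous_mult (F G : C -> C) (z : C) :
  Ccontinuous F z -> Ccontinuous G z -> Ccontinuous (fun w => F w * G w)%C z.
Proof. exact (@continuous_mult (AbsRing_UniformSpace C_AbsRing) C_AbsRing F G z). Qed.

Lemma Ccontinuous_const (c z : C) : Ccontinuous (fun _ => c) z.
Proof. apply continuous_const. Qed.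

Lemma Ccontinuous_comp (F G : C -> C) (z : C) :
  Ccontinuous G z -> Ccontinuous F (G z) -> Ccontinuous (fun w => F (G w)) z.
Proof.
  exact (@continuous_comp (AbsRing_UniformSpace C_AbsRing)
    (AbsRing_UniformSpace C_AbsRing) (AbsRing_UniformSpace C_AbsRing) G F z).
Qed.

Lemma Ccontinuous_div (F G : C -> C) (z : C) :
  Ccontinuous F z -> Ccontinuous G z -> G z <> RtoC 0 ->
  Ccontinuous (fun w => F w / G w)%C z.
Proof.
  intros HF HG H0. apply (Ccontinuous_mult F (fun w => / G w)%C); [exact HF|].
  apply (Ccontinuous_comp Cinv G); [exact HG|].
  exact (is_Cderive_continuous _ _ _ (is_Cderive_inv _ H0)).
Qed.

(** * Cauchy-Riemann equations *)

Lemma Cmod_le_Rabs (a b : R) : Cmod (a, b) <= Rabs a + Rabs b.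
Proof.
  unfold Cmod; simpl.
  rewrite <- (sqrt_Rsqr (Rabs a + Rabs b))
    by (assert (H := Rabs_pos a); assert (H' := Rabs_pos b); lra).
  apply sqrt_le_1_alt. unfold Rsqr.
  assert (H := Rabs_pos a); assert (H' := Rabs_pos b).
  assert (Ha : a * a = Rabs a * Rabs a)
    by (rewrite <- Rabs_mult; symmetry; apply Rabs_pos_eq; nra).
  assert (Hb : b * b = Rabs b * Rabs b)
    by (rewrite <- Rabs_mult; symmetry; apply Rabs_pos_eq; nra).
  nra.
Qed.

Lemma Rabs_fst_le_Cmod (z : C) : Rabs (fst z) <= Cmod z.
Proof. exact (Rle_trans _ _ _ (Rmax_l _ _) (Rmax_Cmod z)). Qed.

Lemma Rabs_snd_le_Cmod (z : C) : Rabs (snd z) <= Cmod z.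
Proof. exact (Rle_trans _ _ _ (Rmax_r _ _) (Rmax_Cmod z)). Qed.

Lemma Cmod_pair_lt (a b d : R) : Rabs a < d / 2 -> Rabs b < d / 2 -> Cmod (a, b) < d.
Proof. intros Ha Hb. assert (H := Cmod_le_Rabs a b). lra. Qed.

(** Multiplication by [a + i b] is the real matrix with rows [(a, -b)] and
[(b, a)]. *)
Lemma Cauchy_Riemann_forward (F : C -> C) (x y a b : R) :
  is_Cderive F (x, y) (a, b) ->
  differentiable_pt_lim (fun u v => fst (F (u, v))) x y a (- b) /\
  differentiable_pt_lim (fun u v => snd (F (u, v))) x y b a.
Proof.
  intros H.
  assert (K : forall eps : posreal, exists d : posreal, forall u v,
    Rabs (u - x) < d -> Rabs (v - y) < d ->
    Cmod (F (u, v) - F (x, y) - ((u, v) - (x, y)) * (a, b))%C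
      <= eps * Rmax (Rabs (u - x)) (Rabs (v - y))).
  { intros eps.
    assert (He : 0 < eps / 2) by (assert (E := cond_pos eps); lra).
    destruct (proj1 (is_Cderive_eps _ _ _) H (mkposreal _ He)) as [d Hd].
    assert (Hd2 : 0 < d / 2) by (assert (E := cond_pos d); lra).
    exists (mkposreal _ Hd2); simpl; intros u v Hu Hv.
    eapply Rle_trans; [apply Hd; now apply Cmod_pair_lt|]. simpl.
    assert (E := Cmod_le_Rabs (u - x) (v - y)).
    assert (E1 := Rmax_l (Rabs (u - x)) (Rabs (v - y))).
    assert (E2 := Rmax_r (Rabs (u - x)) (Rabs (v - y))).
    change (Cmod ((u, v) - (x, y))%C) with (Cmod (u - x, v - y)).
    assert (E3 := cond_pos eps). nra. }
  split; intros eps; destruct (K eps) as [d Hd]; exists d; intros u v Hu Hv;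
    (eapply Rle_trans; [|exact (Hd u v Hu Hv)]).
  - eapply Rle_trans; [|apply Rabs_fst_le_Cmod]. apply Req_le. f_equal.
    simpl. ring.
  - eapply Rle_trans; [|apply Rabs_snd_le_Cmod]. apply Req_le. f_equal.
    simpl. ring.
Qed.

Lemma Cauchy_Riemann_backward (F : C -> C) (x y a b : R) :
  differentiable_pt_lim (fun u v => fst (F (u, v))) x y a (- b) ->
  differentiable_pt_lim (fun u v => snd (F (u, v))) x y b a ->
  is_Cderive F (x, y) (a, b).
Proof.
  intros H1 H2. apply is_Cderive_eps. intros eps.
  assert (He : 0 < eps / 2) by (assert (E := cond_pos eps); lra).
  destruct (H1 (mkposreal _ He)) as [d1 Hd1].
  destruct (H2 (mkposreal _ He)) as [d2 Hd2].
  assert (Hd : 0 < Rmin d1 d2) by (apply Rmin_pos; apply cond_pos).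
  exists (mkposreal _ Hd); simpl; intros [u v] Hw.
  assert (E1 : Rabs (u - x) <= Cmod ((u, v) - (x, y))%C)
    by exact (Rabs_fst_le_Cmod ((u, v) - (x, y))%C).
  assert (E2 : Rabs (v - y) <= Cmod ((u, v) - (x, y))%C)
    by exact (Rabs_snd_le_Cmod ((u, v) - (x, y))%C).
  assert (Ew1 := Rlt_le_trans _ _ _ Hw (Rmin_l _ _)).
  assert (Ew2 := Rlt_le_trans _ _ _ Hw (Rmin_r _ _)).
  specialize (Hd1 u v ltac:(lra) ltac:(lra)).
  specialize (Hd2 u v ltac:(lra) ltac:(lra)).
  simpl in Hd1, Hd2.
  assert (E3 : Rmax (Rabs (u - x)) (Rabs (v - y)) <= Cmod ((u, v) - (x, y))%C)
    by now apply Rmax_lub.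
  destruct (F (u, v) - F (x, y) - ((u, v) - (x, y)) * (a, b))%C as [p q] eqn:E.
  assert (Ep := f_equal fst E). assert (Eq := f_equal snd E). simpl in Ep, Eq.
  assert (EE := Cmod_le_Rabs p q).
  replace (fst (F (u, v)) - fst (F (x, y)) - (a * (u - x) + - b * (v - y)))
    with p in Hd1 by (rewrite <- Ep; ring).
  replace (snd (F (u, v)) - snd (F (x, y)) - (b * (u - x) + a * (v - y)))
    with q in Hd2 by (rewrite <- Eq; ring).
  assert (E4 := cond_pos eps). nra.
Qed.

Lemma Ccontinuous_parts (F : C -> C) (x y : R) :
  Ccontinuous F (x, y) <->
  continuity_2d_pt (fun u v => fst (F (u, v))) x y /\
  continuity_2d_pt (fun u v => snd (F (u, v))) x y.
Proof.
  rewrite Ccontinuous_eps. split.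
  - intros H; split; intros eps; destruct (H eps) as [d Hd];
      (assert (Hd2 : 0 < d / 2) by (assert (E := cond_pos d); lra));
      exists (mkposreal _ Hd2); simpl; intros u v Hu Hv;
      specialize (Hd (u, v) (Cmod_pair_lt _ _ _ Hu Hv));
      (eapply Rle_lt_trans; [|exact Hd]).
    + apply (Rabs_fst_le_Cmod (F (u, v) - F (x, y))%C).
    + apply (Rabs_snd_le_Cmod (F (u, v) - F (x, y))%C).
  - intros [H1 H2] eps.
    assert (He : 0 < eps / 2) by (assert (E := cond_pos eps); lra).
    destruct (H1 (mkposreal _ He)) as [d1 Hd1].
    destruct (H2 (mkposreal _ He)) as [d2 Hd2].
    assert (Hd : 0 < Rmin d1 d2) by (apply Rmin_pos; apply cond_pos).
    exists (mkposreal _ Hd); simpl; intros [u v] Hw.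
    assert (E1 : Rabs (u - x) <= Cmod ((u, v) - (x, y))%C)
      by exact (Rabs_fst_le_Cmod ((u, v) - (x, y))%C).
    assert (E2 : Rabs (v - y) <= Cmod ((u, v) - (x, y))%C)
      by exact (Rabs_snd_le_Cmod ((u, v) - (x, y))%C).
    assert (Ew1 := Rlt_le_trans _ _ _ Hw (Rmin_l _ _)).
    assert (Ew2 := Rlt_le_trans _ _ _ Hw (Rmin_r _ _)).
    specialize (Hd1 u v ltac:(lra) ltac:(lra)).
    specialize (Hd2 u v ltac:(lra) ltac:(lra)).
    simpl in Hd1, Hd2.
    destruct (F (u, v) - F (x, y))%C as [p q] eqn:E.
    assert (Ep := f_equal fst E). assert (Eq := f_equal snd E). simpl in Ep, Eq.
    apply Cmod_pair_lt; [rewrite <- Ep | rewrite <- Eq]; assumption.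
Qed.

Lemma in_disk_near (z : C) :
  in_disk z -> forall w, Cmod (w - z) < 1 - Cmod z -> in_disk w.
Proof.
  intros Hz w Hw. unfold in_disk in *.
  assert (H := Cmod_triangle z (w - z)%C).
  replace (z + (w - z))%C with w in H by ring. lra.
Qed.

Lemma locally_2d_in_disk (x y : R) (P : R -> R -> Prop) :
  in_disk (x, y) -> (forall u v, in_disk (u, v) -> P u v) -> locally_2d P x y.
Proof.
  intros Hz HP.
  assert (Hd : 0 < (1 - Cmod (x, y)) / 2) by (unfold in_disk in Hz; lra).
  exists (mkposreal _ Hd); simpl; intros u v Hu Hv.
  apply HP, (in_disk_near _ Hz).
  change (Cmod (u - x, v - y) < 1 - Cmod (x, y)).
  now apply Cmod_pair_lt.
Qed.

Lemma is_Cderive_ext_disk (F G : C -> C) (z l : C) :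
  in_disk z -> (forall w, in_disk w -> F w = G w) ->
  is_Cderive F z l -> is_Cderive G z l.
Proof.
  intros Hz HFG. apply (is_Cderive_ext_loc _ _ _ _ (1 - Cmod z)).
  - unfold in_disk in Hz; lra.
  - intros w Hw. apply HFG, (in_disk_near _ Hz _ Hw).
Qed.

(** * Circle means and the Cauchy estimate *)

(** Continuity of the derivative is kept as part of the notion: it is what allows
differentiation under the integral sign, without appeal to Goursat's theorem. *)
Definition C1_holomorphic (F F' : C -> C) : Prop :=
  forall z, in_disk z -> is_Cderive F z (F' z) /\ Ccontinuous F' z.

Lemma is_Cderive_along_path (F : C -> C) (c s : R -> R) (t a b dc ds : R) :
  is_Cderive F (c t, s t) (a, b) -> is_derive c t dc -> is_derive s t ds ->
  is_derive (fun r => fst (F (c r, s r))) t (a * dc - b * ds) /\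
  is_derive (fun r => snd (F (c r, s r))) t (b * dc + a * ds).
Proof.
  intros HF Hc Hs. destruct (Cauchy_Riemann_forward _ _ _ _ _ HF) as [H1 H2].
  apply is_derive_Reals in Hc. apply is_derive_Reals in Hs.
  split; apply is_derive_Reals.
  - replace (a * dc - b * ds) with (a * dc + - b * ds) by ring.
    now apply (derivable_pt_lim_comp_2d (fun u v => fst (F (u, v)))).
  - now apply (derivable_pt_lim_comp_2d (fun u v => snd (F (u, v)))).
Qed.

Lemma is_derive_mult_plus_mult (p q c s : R -> R) (t dp dq dc ds : R) :
  is_derive p t dp -> is_derive q t dq -> is_derive c t dc -> is_derive s t ds ->
  is_derive (fun r => p r * c r + q r * s r) t
    (dp * c t + p t * dc + (dq * s t + q t * ds)).
Proof.
  intros Hp Hq Hc Hs.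
  apply (is_derive_plus (V := R_NormedModule));
    apply (is_derive_mult (K := R_AbsRing)); trivial; exact Rmult_comm.
Qed.

Definition polar (t th : R) : C := (t * cos th, t * sin th).

Lemma in_disk_polar (t th : R) : Rabs t < 1 -> in_disk (polar t th).
Proof.
  intros Ht. unfold in_disk, Cmod; simpl.
  replace (_ + _) with (Rsqr t * (Rsqr (sin th) + Rsqr (cos th)))
    by (unfold Rsqr; ring).
  rewrite sin2_cos2, Rmult_1_r, sqrt_Rsqr_abs. exact Ht.
Qed.

(** The equation [t K'(t) = K(t)] says that [K(t) / t] is constant for positive [t],
and the constant is the limit [K'(0)] at 0.  So [K'(0) t <= M] for all [t < 1]. *)
Lemma homogeneous_derivative_bound (K L : R -> R) (M : R) :
  (forall t, Rabs t < 1 -> is_derive K t (L t) /\ t * L t = K t /\ Rabs (K t) <= M) ->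
  L 0 <= M.
Proof.
  intros H.
  assert (Hc : forall s t, 0 < s -> s < t -> t < 1 -> K s / s = K t / t).
  { intros s t Hs Hst Ht.
    apply (eq_is_derive (fun r => K r / r) s t); [|exact Hst].
    intros r Hr.
    destruct (H r) as (H1 & H2 & _); [rewrite Rabs_pos_eq; lra|].
    evar_last.
    - apply is_derive_div; [exact H1 | apply (is_derive_id (K := R_AbsRing)) | lra].
    - change one with 1. change zero with 0. rewrite <- H2. field. lra. }
  assert (HK0 : K 0 = 0).
  { destruct (H 0) as (_ & H2 & _); [rewrite Rabs_R0; lra|]. rewrite <- H2; ring. }
  assert (Hlin : forall t, 0 < t < 1 -> K t = L 0 * t).
  { intros t Ht.
    assert (E : K t / t = L 0); [|rewrite <- E; field; lra].
    apply cond_eq. intros eps He.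
    destruct (H 0) as (H1 & _); [rewrite Rabs_R0; lra|].
    apply is_derive_Reals in H1. destruct (H1 eps He) as [d Hd].
    set (s := Rmin d t / 2).
    assert (Hs : 0 < s /\ s < d /\ s < t).
    { assert (E1 := Rmin_l d t). assert (E2 := Rmin_r d t).
      assert (0 < Rmin d t) by (apply Rmin_pos; [apply cond_pos | lra]).
      unfold s; lra. }
    specialize (Hd s ltac:(lra) ltac:(rewrite Rabs_pos_eq; lra)).
    rewrite Rplus_0_l, HK0, Rminus_0_r in Hd.
    rewrite <- (Hc s t) by lra. exact Hd. }
  apply Rnot_lt_le. intros HM.
  assert (HM0 : 0 <= M).
  { destruct (H 0) as (_ & _ & H3); [rewrite Rabs_R0; lra|].
    assert (E := Rabs_pos (K 0)). lra. }
  set (t := (M + L 0) / 2 / L 0).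
  assert (Ht : 0 < t < 1).
  { split; [apply Rdiv_lt_0_compat; lra|].
    unfold t. apply Rlt_div_l; lra. }
  destruct (H t) as (_ & _ & H3); [rewrite Rabs_pos_eq; lra|].
  rewrite (Hlin t Ht) in H3.
  assert (E := Rle_abs (L 0 * t)).
  replace (L 0 * t) with ((M + L 0) / 2) in * by (unfold t; field; lra). lra.
Qed.

(** Applied to [F'], this is the radial derivative of [spun_re F], since
[F(t e^{i th}) e^{-i th}] has [t]-derivative [F'(t e^{i th})]. *)
Definition re_on_circle (F : C -> C) (t th : R) : R := fst (F (polar t th)).

(** The real part of [F(t e^{i th}) e^{-i th}]. *)
Definition spun_re (F : C -> C) (t th : R) : R :=
  fst (F (polar t th)) * cos th + snd (F (polar t th)) * sin th.

(** The imaginary part of [F(t e^{i th}) e^{-i th}]. *)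
Definition spun_im (F : C -> C) (t th : R) : R :=
  snd (F (polar t th)) * cos th + fst (F (polar t th)) * - sin th.

Lemma spun_re_derive_radius (F F' : C -> C) (t th : R) :
  C1_holomorphic F F' -> Rabs t < 1 ->
  is_derive (fun r => spun_re F r th) t (re_on_circle F' t th).
Proof.
  intros HF Ht. assert (Hd := in_disk_polar t th Ht).
  destruct (HF _ Hd) as [HD _].
  unfold re_on_circle, spun_re. destruct (F' (polar t th)) as [a0 b0]; simpl.
  destruct (is_Cderive_along_path F (fun r => r * cos th) (fun r => r * sin th)
    t a0 b0 (cos th) (sin th)) as [H1 H2].
  - exact HD.
  - auto_derive; [trivial | ring].
  - auto_derive; [trivial | ring].
  - evar_last.
    + apply is_derive_mult_plus_mult; [exact H1 | exact H2 | |];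
        apply (is_derive_const (V := R_NormedModule)).
    + change zero with 0. simpl.
      assert (E := sin2_cos2 th). unfold Rsqr in E.
      transitivity (a0 * (sin th * sin th + cos th * cos th)); [ring|].
      rewrite E; ring.
Qed.

(** The [th]-derivative of [F(t e^{i th}) e^{-i th}] is
[i (t F'(t e^{i th}) - F(t e^{i th}) e^{-i th})]. *)
Lemma spun_im_derive_angle (F F' : C -> C) (t th : R) :
  C1_holomorphic F F' -> Rabs t < 1 ->
  is_derive (fun r => spun_im F t r) th
    (t * re_on_circle F' t th - spun_re F t th).
Proof.
  intros HF Ht. assert (Hd := in_disk_polar t th Ht).
  destruct (HF _ Hd) as [HD _].
  unfold re_on_circle, spun_re, spun_im. destruct (F' (polar t th)) as [a0 b0]; simpl.
  destruct (is_Cderive_along_path F (fun r => t * cos r) (fun r => t * sin r)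
    th a0 b0 (- t * sin th) (t * cos th)) as [H1 H2].
  - exact HD.
  - auto_derive; [trivial | ring].
  - auto_derive; [trivial | ring].
  - evar_last.
    + apply is_derive_mult_plus_mult; [exact H2 | exact H1 | |].
      * apply is_derive_cos.
      * apply (is_derive_opp (V := R_NormedModule)), is_derive_sin.
    + change opp with Ropp. simpl.
      assert (E := sin2_cos2 th). unfold Rsqr in E.
      transitivity (t * (a0 * (sin th * sin th + cos th * cos th)) -
        (fst (F (polar t th)) * cos th
         + snd (F (polar t th)) * sin th)); [ring|].
      rewrite E; ring.
Qed.

Lemma re_on_circle_continuity_2d (F F' : C -> C) (t th : R) :
  C1_holomorphic F F' -> Rabs t < 1 -> continuity_2d_pt (re_on_circle F') t th.
Proof.
  intros HF Ht. destruct (HF _ (in_disk_polar t th Ht)) as [_ HC].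
  apply Ccontinuous_parts in HC. destruct HC as [HC _].
  apply continuity_2d_pt_filterlim.
  apply continuity_2d_pt_filterlim in HC.
  assert (P : forall c : R -> R, continuity_pt c th ->
    filterlim (fun z : R * R => fst z * c (snd z))
      (locally (t, th)) (locally (t * c th))).
  { intros c Hc. apply (continuity_2d_pt_filterlim (fun u v => u * c v)).
    apply continuity_2d_pt_mult; [apply continuity_2d_pt_id1|].
    apply continuity_1d_2d_pt_comp; [exact Hc | apply continuity_2d_pt_id2]. }
  unfold re_on_circle.
  apply (filterlim_comp_2 (G := locally (t * cos th)) (H := locally (t * sin th))
    (I := locally (fst (F' (polar t th))))
    (fun z : R * R => fst z * cos (snd z)) (fun z : R * R => fst z * sin (snd z))
    (fun u v => fst (F' (u, v)))).
  - apply P, continuity_cos.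
  - apply P, continuity_sin.
  - intros Q HQ. apply HC in HQ. destruct HQ as [e He].
    apply (Filter_prod _ _ _ (ball (t * cos th) e) (ball (t * sin th) e)).
    + apply locally_ball.
    + apply locally_ball.
    + intros u v Hu Hv. apply (He (u, v)). now split.
Qed.

Lemma continuity_2d_second (f : R -> R -> R) (x y : R) :
  continuity_2d_pt f x y -> continuous (f x) y.
Proof.
  intros H. apply continuity_pt_filterlim. apply continuity_pt_locally.
  intros eps. destruct (H eps) as [d Hd]. exists d. intros v Hv.
  apply Hd; [rewrite Rminus_diag, Rabs_R0; apply cond_pos | exact Hv].
Qed.

Lemma re_on_circle_continuous (F F' : C -> C) (t th : R) :
  C1_holomorphic F F' -> Rabs t < 1 -> continuous (re_on_circle F' t) th.
Proof.
  intros HF Ht. now apply continuity_2d_second, (re_on_circle_continuity_2d F F').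
Qed.

Lemma spun_re_continuous (F F' : C -> C) (t th : R) :
  C1_holomorphic F F' -> Rabs t < 1 -> continuous (spun_re F t) th.
Proof.
  intros HF Ht. unfold spun_re.
  destruct (HF _ (in_disk_polar t th Ht)) as [HD _].
  destruct (F' (polar t th)) as [a0 b0].
  destruct (is_Cderive_along_path F (fun r => t * cos r) (fun r => t * sin r)
    th a0 b0 (- t * sin th) (t * cos th)) as [H1 H2].
  - exact HD.
  - auto_derive; [trivial | ring].
  - auto_derive; [trivial | ring].
  - apply (ex_derive_continuous (V := R_NormedModule)).
    eexists. apply is_derive_mult_plus_mult; [exact H1 | exact H2 | |].
    + apply is_derive_cos.
    + apply is_derive_sin.
Qed.

Lemma ex_RInt_spun_re (F F' : C -> C) (t : R) :
  C1_holomorphic F F' -> Rabs t < 1 -> ex_RInt (spun_re F t) 0 (2 * PI).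
Proof.
  intros HF Ht. apply (ex_RInt_continuous (V := R_CompleteNormedModule)).
  intros th _. now apply (spun_re_continuous F F').
Qed.

Lemma ex_RInt_re_on_circle (F F' : C -> C) (t : R) :
  C1_holomorphic F F' -> Rabs t < 1 -> ex_RInt (re_on_circle F' t) 0 (2 * PI).
Proof.
  intros HF Ht. apply (ex_RInt_continuous (V := R_CompleteNormedModule)).
  intros th _. now apply (re_on_circle_continuous F F').
Qed.

Lemma Rabs_spun_re_le (F : C -> C) (t th : R) :
  (forall z, in_disk z -> Cmod (F z) <= 1) -> Rabs t < 1 -> Rabs (spun_re F t th) <= 1.
Proof.
  intros HF1 Ht. assert (HB := HF1 _ (in_disk_polar t th Ht)).
  unfold spun_re. set (w := F (polar t th)) in *.
  assert (E : fst w * cos th + snd w * sin th = Re (w * (cos th, Ropp (sin th)))%C)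
    by (simpl; ring).
  rewrite E. eapply Rle_trans; [apply re_le_Cmod|].
  rewrite Cmod_mult.
  replace (Cmod (cos th, Ropp (sin th))) with 1; [lra|].
  unfold Cmod; simpl.
  replace (_ + _) with (Rsqr (sin th) + Rsqr (cos th)) by (unfold Rsqr; ring).
  now rewrite sin2_cos2, sqrt_1.
Qed.

Lemma locally_Rabs_lt_1 (t : R) (P : R -> Prop) :
  Rabs t < 1 -> (forall s, Rabs s < 1 -> P s) -> locally t P.
Proof.
  intros Ht HP. assert (Hd : 0 < 1 - Rabs t) by lra.
  exists (mkposreal _ Hd). intros s Hs. simpl in s. apply HP.
  change (Rabs (s - t) < 1 - Rabs t) in Hs.
  assert (E := Rabs_triang (s - t) t). replace (s - t + t) with s in E by ring. lra.
Qed.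

Lemma is_derive_RInt_spun_re (F F' : C -> C) (t : R) :
  C1_holomorphic F F' -> Rabs t < 1 ->
  is_derive (fun s => RInt (spun_re F s) 0 (2 * PI)) t
    (RInt (re_on_circle F' t) 0 (2 * PI)).
Proof.
  intros HF Ht.
  rewrite (RInt_ext (re_on_circle F' t) (fun th => Derive (fun u => spun_re F u th) t)).
  - apply (is_derive_RInt_param (spun_re F)).
    + apply locally_Rabs_lt_1; [exact Ht|]. intros s Hs th _.
      exists (re_on_circle F' s th). now apply spun_re_derive_radius.
    + intros th _. apply (continuity_2d_pt_ext_loc (re_on_circle F'));
        [|now apply (re_on_circle_continuity_2d F F')].
      assert (Hd : 0 < 1 - Rabs t) by lra.
      exists (mkposreal _ Hd). intros u v Hu _. cbn in Hu.
      symmetry. apply is_derive_unique, spun_re_derive_radius; [exact HF|].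
      assert (E := Rabs_triang (u - t) t). replace (u - t + t) with u in E by ring. lra.
    + apply locally_Rabs_lt_1; [exact Ht|].
      intros s Hs. now apply (ex_RInt_spun_re F F').
  - intros th _. symmetry. now apply is_derive_unique, spun_re_derive_radius.
Qed.

(** The angular derivative of the [2 pi]-periodic function [spun_im F t] integrates
to 0 over a period. *)
Lemma RInt_spun_re_homogeneous (F F' : C -> C) (t : R) :
  C1_holomorphic F F' -> Rabs t < 1 ->
  t * RInt (re_on_circle F' t) 0 (2 * PI) = RInt (spun_re F t) 0 (2 * PI).
Proof.
  intros HF Ht.
  assert (H : is_RInt (fun th => t * re_on_circle F' t th - spun_re F t th)
    0 (2 * PI) (spun_im F t (2 * PI) - spun_im F t 0)).
  { apply (is_RInt_derive (V := R_CompleteNormedModule) (spun_im F t)).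
    - intros th _. now apply spun_im_derive_angle.
    - intros th _. apply (continuous_minus (V := R_NormedModule)).
      + apply (continuous_scal_r (V := R_NormedModule) t (re_on_circle F' t)).
        now apply (re_on_circle_continuous F F').
      + now apply (spun_re_continuous F F'). }
  assert (E : spun_im F t (2 * PI) - spun_im F t 0 = 0).
  { unfold spun_im, polar. rewrite cos_2PI, sin_2PI, cos_0, sin_0. ring. }
  rewrite E in H. apply (is_RInt_unique (V := R_CompleteNormedModule)) in H.
  rewrite (RInt_minus (V := R_CompleteNormedModule)
    (fun th => t * re_on_circle F' t th)) in H.
  - rewrite (RInt_scal (V := R_CompleteNormedModule) (re_on_circle F' t)) in H
      by now apply (ex_RInt_re_on_circle F F').
    unfold minus, plus, opp, scal in H; simpl in H. unfold mult in H; simpl in H. lra.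
  - apply (ex_RInt_scal (V := R_NormedModule)). now apply (ex_RInt_re_on_circle F F').
  - now apply (ex_RInt_spun_re F F').
Qed.

Lemma Re_derive_0_le_1 (F F' : C -> C) :
  C1_holomorphic F F' -> (forall z, in_disk z -> Cmod (F z) <= 1) ->
  fst (F' (RtoC 0)) <= 1.
Proof.
  intros HF HF1. assert (HPI := PI_RGT_0).
  assert (H : RInt (re_on_circle F' 0) 0 (2 * PI) <= 2 * PI).
  { apply (homogeneous_derivative_bound (fun s => RInt (spun_re F s) 0 (2 * PI))
      (fun s => RInt (re_on_circle F' s) 0 (2 * PI))).
    intros t Ht. split; [|split].
    - now apply is_derive_RInt_spun_re.
    - now apply RInt_spun_re_homogeneous.
    - rewrite <- (Rmult_1_r (2 * PI)) at 2. rewrite <- (Rminus_0_r (2 * PI)) at 2.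
      apply abs_RInt_le_const; [lra | now apply (ex_RInt_spun_re F F') |].
      intros th _. now apply Rabs_spun_re_le. }
  rewrite (RInt_ext _ (fun _ => fst (F' (RtoC 0)))) in H.
  - rewrite RInt_const in H. unfold scal in H; simpl in H; unfold mult in H; simpl in H.
    nra.
  - intros th _. unfold re_on_circle, polar. now rewrite !Rmult_0_l.
Qed.

(** Rotating [F] by a unimodular constant makes [F'(0)] real and nonnegative. *)
Lemma Cauchy_estimate (F F' : C -> C) :
  C1_holomorphic F F' -> (forall z, in_disk z -> Cmod (F z) <= 1) ->
  Cmod (F' (RtoC 0)) <= 1.
Proof.
  intros HF HF1.
  destruct (Req_dec (Cmod (F' (RtoC 0))) 0) as [E|E]; [rewrite E; lra|].
  set (w := F' (RtoC 0)) in *.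
  assert (Hw : w <> RtoC 0) by (intros E'; apply E; rewrite E'; apply Cmod_0).
  set (c := (Cconj w / RtoC (Cmod w))%C).
  assert (HC : RtoC (Cmod w) <> RtoC 0)
    by (intros E'; apply E; now apply RtoC_inj in E').
  assert (Hc : Cmod c = 1).
  { unfold c. rewrite Cmod_div, Cmod_conj, Cmod_R, Rabs_pos_eq
      by (trivial; apply Cmod_ge_0).
    field. exact E. }
  assert (H : fst (c * F' (RtoC 0))%C <= 1).
  { apply (Re_derive_0_le_1 (fun z => c * F z)%C (fun z => c * F' z)%C).
    - intros z Hz. destruct (HF z Hz) as [H1 H2]. split.
      + now apply is_Cderive_scal.
      + apply Ccontinuous_mult; [apply Ccontinuous_const | exact H2].
    - intros z Hz. rewrite Cmod_mult, Hc, Rmult_1_l. now apply HF1. }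
  fold w in H.
  assert (E1 : (c * w)%C = RtoC (Cmod w)).
  { unfold c. transitivity (w * Cconj w / RtoC (Cmod w))%C; [field; exact HC|].
    rewrite <- Cmod2_conj, <- RtoC_div by exact E. f_equal. field. exact E. }
  rewrite E1 in H. exact H.
Qed.

(** * The Schwarz-Pick inequality *)

(** Used both for disk automorphisms, with [u = 1], and for the factor
[(eps conj h' + conj g') / (h' + eps g')]. *)
Lemma Cmod_sq_shear (e u v : C) :
  Cmod (u + e * v) ^ 2 - Cmod (e * Cconj u + Cconj v) ^ 2
  = (1 - Cmod e ^ 2) * (Cmod u ^ 2 - Cmod v ^ 2).
Proof. rewrite !Cmod2_alt. destruct e, u, v; simpl. ring. Qed.

Lemma Cmod_lt_of_sq (u v : C) : 0 < Cmod u ^ 2 - Cmod v ^ 2 -> Cmod v < Cmod u.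
Proof. intros H. assert (H1 := Cmod_ge_0 u). assert (H2 := Cmod_ge_0 v). nra. Qed.

Lemma Cmod_le_of_sq (u v : C) : 0 <= Cmod u ^ 2 - Cmod v ^ 2 -> Cmod v <= Cmod u.
Proof. intros H. assert (H1 := Cmod_ge_0 u). assert (H2 := Cmod_ge_0 v). nra. Qed.

Lemma Cmod_pos_neq_0 (u : C) : 0 < Cmod u -> u <> RtoC 0.
Proof. apply Cmod_gt_0. Qed.

Lemma one_minus_sq_pos (z : C) : in_disk z -> 0 < 1 - Cmod z ^ 2.
Proof. unfold in_disk. intros H. assert (H1 := Cmod_ge_0 z). nra. Qed.

Lemma one_minus_sq_nonneg (z : C) : in_closed_disk z -> 0 <= 1 - Cmod z ^ 2.
Proof. unfold in_closed_disk. intros H. assert (H1 := Cmod_ge_0 z). nra. Qed.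

Lemma Cmod_moebius_lt (a w : C) :
  in_disk a -> in_disk w -> Cmod (w + a) < Cmod (1 + Cconj a * w).
Proof.
  intros Ha Hw. apply Cmod_lt_of_sq.
  assert (E := Cmod_sq_shear (Cconj a) (RtoC 1) w).
  rewrite <- (Cmod_conj (w + a)), Cplus_conj.
  replace (Cconj w + Cconj a)%C with (Cconj a * Cconj (RtoC 1) + Cconj w)%C.
  - rewrite E, Cmod_conj, Cmod_1. 
    apply one_minus_sq_pos in Ha, Hw. 
    apply Rmult_lt_0_compat; lra.
  - replace (Cconj (RtoC 1)) with (RtoC 1); [ring|].
    unfold Cconj, RtoC; simpl. now rewrite Ropp_0.
Qed.

(** Apply the Cauchy estimate to [Q] composed with the automorphism
[w -> (w + a) / (1 + conj a w)], whose derivative at 0 is [1 - |a|^2]. *)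
Lemma Schwarz_Pick_at (Q Q' : C -> C) (a : C) :
  C1_holomorphic Q Q' -> (forall z, in_disk z -> Cmod (Q z) <= 1) -> in_disk a ->
  (1 - Cmod a ^ 2) * Cmod (Q' a) <= 1.
Proof.
  intros HQ HQ1 Ha.
  set (den := fun w => (RtoC 1 + Cconj a * w)%C).
  set (phi := fun w => ((w + a) / den w)%C).
  set (phi' := fun w => ((1 * den w - (w + a) * Cconj a) / (den w * den w))%C).
  assert (Hden : forall w, in_disk w -> den w <> RtoC 0).
  { intros w Hw. apply Cmod_pos_neq_0.
    assert (E := Cmod_moebius_lt a w Ha Hw). assert (E' := Cmod_ge_0 (w + a)).
    unfold den. lra. }
  assert (Hphi : forall w, in_disk w -> in_disk (phi w)).
  { intros w Hw. unfold in_disk, phi. rewrite Cmod_div by now apply Hden.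
    apply Rlt_div_l; [now apply Cmod_gt_0, Hden|].
    rewrite Rmult_1_l. now apply Cmod_moebius_lt. }
  assert (Dden : forall w, is_Cderive den w (Cconj a)).
  { intros w. apply is_Cderive_affine. }
  assert (Dnum : forall w, is_Cderive (fun w => w + a)%C w (RtoC 1)).
  { intros w. apply (is_Cderive_ext_loc (fun w => a + RtoC 1 * w)%C _ _ _ 1).
    - lra.
    - intros v _. ring.
    - apply is_Cderive_affine. }
  assert (Dphi : forall w, in_disk w -> is_Cderive phi w (phi' w)).
  { intros w Hw. apply (is_Cderive_div (fun w => w + a)%C den w (RtoC 1) (Cconj a));
      [apply Dnum | apply Dden | now apply Hden]. }
  assert (Cden : forall w, Ccontinuous den w)
    by (intros w; exact (is_Cderive_continuous _ _ _ (Dden w))).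
  assert (Cnum : forall w, Ccontinuous (fun w => w + a)%C w)
    by (intros w; exact (is_Cderive_continuous _ _ _ (Dnum w))).
  assert (K := Cauchy_estimate (fun w => Q (phi w)) (fun w => phi' w * Q' (phi w))%C).
  assert (H0 : in_disk (RtoC 0)) by (unfold in_disk; rewrite Cmod_0; lra).
  assert (Hm := one_minus_sq_pos _ Ha).
  assert (E0 : phi (RtoC 0) = a).
  { unfold phi, den. rewrite Cmult_0_r, Cplus_0_l, Cplus_0_r. field. }
  assert (E1 : phi' (RtoC 0) = RtoC (1 - Cmod a ^ 2)).
  { unfold phi', den. rewrite RtoC_minus, Cmod2_conj. field. }
  cbv beta in K. rewrite E0, E1, Cmod_mult, Cmod_R, Rabs_pos_eq in K by lra.
  apply K.
  - intros w Hw. destruct (HQ _ (Hphi w Hw)) as [H1 H2]. split.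
    + apply is_Cderive_comp; [exact H1 | now apply Dphi].
    + apply Ccontinuous_mult.
      * unfold phi'. apply Ccontinuous_div.
        -- apply Ccontinuous_minus; apply Ccontinuous_mult;
             trivial; apply Ccontinuous_const.
        -- now apply Ccontinuous_mult.
        -- apply Cmult_neq_0; now apply Hden.
      * apply Ccontinuous_comp; [|exact H2].
        exact (is_Cderive_continuous _ _ _ (Dphi w Hw)).
  - intros w Hw. now apply HQ1, Hphi.
Qed.

Lemma C1_holomorphic_lin (F F' G G' : C -> C) (c : C) :
  C1_holomorphic F F' -> C1_holomorphic G G' ->
  C1_holomorphic (fun z => F z + c * G z)%C (fun z => F' z + c * G' z)%C.
Proof.
  intros HF HG z Hz. destruct (HF z Hz) as [H1 H2]. destruct (HG z Hz) as [H3 H4].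
  split.
  - apply is_Cderive_plus; [exact H1 | now apply is_Cderive_scal].
  - apply Ccontinuous_plus; [exact H2|].
    apply Ccontinuous_mult; [apply Ccontinuous_const | exact H4].
Qed.

Lemma C1_holomorphic_div (F F' G G' : C -> C) :
  C1_holomorphic F F' -> C1_holomorphic G G' ->
  (forall z, in_disk z -> G z <> RtoC 0) ->
  C1_holomorphic (fun z => F z / G z)%C
    (fun z => (F' z * G z - F z * G' z) / (G z * G z))%C.
Proof.
  intros HF HG H0 z Hz. destruct (HF z Hz) as [H1 H2]. destruct (HG z Hz) as [H3 H4].
  assert (CF := is_Cderive_continuous _ _ _ H1).
  assert (CG := is_Cderive_continuous _ _ _ H3).
  split.
  - apply is_Cderive_div; [exact H1 | exact H3 | now apply H0].
  - apply Ccontinuous_div.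
    + now apply Ccontinuous_minus; apply Ccontinuous_mult.
    + now apply Ccontinuous_mult.
    + apply Cmult_neq_0; now apply H0.
Qed.

(** This is [(1 - |a|^2) |omega'(a)| <= 1 - |omega(a)|^2] for [omega = G / H],
multiplied by [|H(a)|^2].  With [b = omega(a)], [Schwarz_Pick_at] is applied to
[(omega - b) / (1 - conj b omega) = (G - b H) / (H - conj b G)], which maps the
disk into itself and vanishes at [a]. *)
Lemma Schwarz_Pick_quotient (H H' G G' : C -> C) (a : C) :
  C1_holomorphic H H' -> C1_holomorphic G G' ->
  (forall z, in_disk z -> Cmod (G z) < Cmod (H z)) -> in_disk a ->
  (1 - Cmod a ^ 2) * Cmod (G' a * H a - G a * H' a)
    <= Cmod (H a) ^ 2 - Cmod (G a) ^ 2.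
Proof.
  intros HH HG Hlt Ha.
  assert (HHa : H a <> RtoC 0).
  { apply Cmod_pos_neq_0. assert (E := Hlt a Ha). assert (E' := Cmod_ge_0 (G a)). lra. }
  assert (HHp : 0 < Cmod (H a)) by now apply Cmod_gt_0.
  set (b := (G a / H a)%C).
  assert (Hb : in_disk b).
  { unfold in_disk, b. rewrite Cmod_div by exact HHa.
    apply Rlt_div_l; [exact HHp|]. rewrite Rmult_1_l. now apply Hlt. }
  assert (HbR := one_minus_sq_pos _ Hb).
  set (N := fun z => (G z + - b * H z)%C).
  set (D := fun z => (H z + - Cconj b * G z)%C).
  assert (HND : forall z, in_disk z -> Cmod (N z) < Cmod (D z)).
  { intros z Hz. apply Cmod_lt_of_sq.
    assert (E := Cmod_sq_shear (- Cconj b)%C (H z) (G z)).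
    replace (Cmod (N z)) with (Cmod (- Cconj b * Cconj (H z) + Cconj (G z))%C).
    - unfold D. rewrite E, Cmod_opp, Cmod_conj. apply Rmult_lt_0_compat; [exact HbR|].
      assert (E1 := Hlt z Hz). assert (E2 := Cmod_ge_0 (G z)). nra.
    - rewrite <- (Cmod_conj (N z)). unfold N. f_equal.
      rewrite Cplus_conj, Cmult_conj, Copp_conj. ring. }
  assert (HD0 : forall z, in_disk z -> D z <> RtoC 0).
  { intros z Hz. apply Cmod_pos_neq_0. assert (E := HND z Hz).
    assert (E' := Cmod_ge_0 (N z)). lra. }
  assert (HQ1 : forall z, in_disk z -> Cmod (N z / D z)%C <= 1).
  { intros z Hz. rewrite Cmod_div by now apply HD0.
    apply Rle_div_l; [now apply Cmod_gt_0, HD0|].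
    rewrite Rmult_1_l. apply Rlt_le. now apply HND. }
  assert (K := Schwarz_Pick_at _ _ a
    (C1_holomorphic_div _ _ _ _ (C1_holomorphic_lin _ _ _ _ (- b)%C HG HH)
       (C1_holomorphic_lin _ _ _ _ (- Cconj b)%C HH HG) HD0)
    HQ1 Ha).
  cbv beta in K.
  change (G a + - b * H a)%C with (N a) in K.
  change (H a + - Cconj b * G a)%C with (D a) in K.
  assert (EN : N a = RtoC 0) by (unfold N, b; field; exact HHa).
  assert (ED : D a = (H a * RtoC (1 - Cmod b ^ 2))%C).
  { rewrite RtoC_minus, Cmod2_conj.
    transitivity (H a + - Cconj b * (b * H a))%C; [|ring].
    unfold D. f_equal. f_equal. unfold b. field. exact HHa. }
  assert (Hr : RtoC (1 - Cmod b ^ 2) <> RtoC 0).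
  { intros E. apply RtoC_inj in E. lra. }
  rewrite EN in K.
  replace (((G' a + - b * H' a) * D a - RtoC 0 * (H' a + - Cconj b * G' a))
           / (D a * D a))%C
    with ((G' a * H a - G a * H' a) / (H a * H a * RtoC (1 - Cmod b ^ 2)))%C in K.
  2:{ rewrite ED. unfold b at 2. field. repeat split; assumption. }
  assert (Hn : (H a * H a * RtoC (1 - Cmod b ^ 2))%C <> RtoC 0)
    by (repeat apply Cmult_neq_0; assumption).
  rewrite Cmod_div in K by exact Hn.
  assert (Eb : Cmod b * Cmod (H a) = Cmod (G a)).
  { unfold b. rewrite <- Cmod_mult. f_equal. field. exact HHa. }
  rewrite !Cmod_mult, Cmod_R, Rabs_pos_eq in K by lra.
  replace (Cmod (H a) * Cmod (H a) * (1 - Cmod b ^ 2))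
    with (Cmod (H a) ^ 2 - Cmod (G a) ^ 2) in K by (rewrite <- Eb; ring).
  assert (HJ : 0 < Cmod (H a) ^ 2 - Cmod (G a) ^ 2).
  { assert (E1 := Hlt a Ha). assert (E2 := Cmod_ge_0 (G a)). nra. }
  unfold Rdiv in K. rewrite <- Rmult_assoc in K. apply Rle_div_l in K; [|exact HJ].
  rewrite Rmult_1_l in K. exact K.
Qed.

(** * Regularity of the derivatives of h and g *)

Lemma differentiable_of_partials (f fx : R -> R -> R) (x y fy : R) :
  in_disk (x, y) ->
  (forall u v, in_disk (u, v) -> is_derive (fun t => f t v) u (fx u v)) ->
  is_derive (fun t => f x t) y fy -> continuity_2d_pt fx x y ->
  differentiable_pt_lim f x y (fx x y) fy.
Proof.
  intros Hz Hx Hy Hc. apply filterdiff_differentiable_pt_lim.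
  apply (is_derive_filterdiff f x y fx fy).
  - destruct (locally_2d_in_disk x y
      (fun u v => is_derive (fun t => f t v) u (fx u v)) Hz Hx) as [d Hd].
    exists d. intros [u v] [Hu Hv]. now apply Hd.
  - exact Hy.
  - now apply continuity_2d_pt_filterlim in Hc.
Qed.

(** On the disk [A' = u_x - i u_y].  Its own Cauchy-Riemann equations are the Laplace
equation for [u] and the symmetry of the second partial derivatives. *)
Lemma C1_holomorphic_derive_of_harmonic_re (A : C -> C) (u : R -> R -> R) :
  analytic_in_disk A -> harmonic_real u ->
  (forall x y, in_disk (x, y) -> fst (A (x, y)) = u x y) ->
  exists A2, C1_holomorphic (C_derive A) A2.
Proof.
  intros HA Hu HAu.
  set (ux := fun x y => Derive (fun t => u t y) x).
  set (uy := fun x y => Derive (fun t => u x t) y).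
  set (uxx := fun x y => Derive (fun t => ux t y) x).
  set (uxy := fun x y => Derive (fun t => ux x t) y).
  set (uyx := fun x y => Derive (fun t => uy t y) x).
  set (uyy := fun x y => Derive (fun t => uy x t) y).
  assert (Hpart : forall x y, in_disk (x, y) ->
    (ex_derive (fun t => u t y) x /\ ex_derive (fun t => u x t) y) /\
    (is_derive (fun t => ux t y) x (uxx x y) /\
     is_derive (fun t => ux x t) y (uxy x y)) /\
    (is_derive (fun t => uy t y) x (uyx x y) /\
     is_derive (fun t => uy x t) y (uyy x y)) /\
    (continuity_2d_pt uxx x y /\ continuity_2d_pt uxy x y /\
     continuity_2d_pt uyx x y) /\
    uxx x y + uyy x y = 0).
  { intros x y Hz. destruct (Hu x y Hz) as [HD HL].
    destruct HD as (_ & D1 & D2 & (_ & D3 & D4 & (C1 & _) & (C2 & _))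
      & (_ & D5 & D6 & (C3 & _) & _)).
    repeat split; try assumption; apply Derive_correct; assumption. }
  assert (Hsym : forall x y, in_disk (x, y) -> uyx x y = uxy x y).
  { intros x y Hz. apply (Schwarz u x y).
    - apply (locally_2d_in_disk _ _ _ Hz). intros v w Hvw.
      destruct (Hpart v w Hvw) as ((D1 & D2) & (_ & D4) & (D5 & _) & _).
      repeat split; try assumption; eexists; eassumption.
    - apply Hpart, Hz.
    - apply Hpart, Hz. }
  assert (HA1 : forall x y, in_disk (x, y) -> (ux x y, - uy x y) = C_derive A (x, y)).
  { intros x y Hz.
    assert (H := C_derive_correct A (x, y) (RtoC 0) (HA _ Hz)).
    apply is_Cderive_C_NormedModule in H.
    destruct (C_derive A (x, y)) as [a b].
    apply Cauchy_Riemann_forward in H. destruct H as [H _].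
    apply (differentiable_pt_lim_ext _ u) in H.
    - apply differentiable_pt_lim_unique in H. destruct H as [H1 H2].
      unfold ux, uy. now rewrite H1, H2, Ropp_involutive.
    - apply (locally_2d_in_disk _ _ _ Hz). exact HAu. }
  exists (fun z => (uxx (fst z) (snd z), - uyx (fst z) (snd z))).
  intros [x y] Hz. simpl.
  destruct (Hpart x y Hz) as (_ & (Dxx & Dxy) & (Dyx & Dyy) & (Cxx & Cxy & Cyx) & HL).
  split.
  - apply (is_Cderive_ext_disk (fun z => (ux (fst z) (snd z), - uy (fst z) (snd z)))).
    + exact Hz.
    + intros [v w] Hvw. now apply HA1.
    + apply Cauchy_Riemann_backward; simpl.
      * rewrite Ropp_involutive, Hsym by exact Hz.
        apply differentiable_of_partials; trivial.
        intros v w Hvw. apply (Hpart v w Hvw).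
      * apply (differentiable_of_partials (fun x y => - uy x y) (fun x y => - uyx x y));
          trivial.
        -- intros v w Hvw. apply (is_derive_opp (V := R_NormedModule)).
           apply (Hpart v w Hvw).
        -- replace (uxx x y) with (- uyy x y) by lra.
           now apply (is_derive_opp (V := R_NormedModule)).
        -- now apply continuity_2d_pt_opp.
  - apply Ccontinuous_parts. split; simpl; [exact Cxx | now apply continuity_2d_pt_opp].
Qed.

Lemma C1_holomorphic_ext (F G F' : C -> C) :
  (forall z, in_disk z -> F z = G z) -> C1_holomorphic F F' -> C1_holomorphic G F'.
Proof.
  intros HFG HF z Hz. destruct (HF z Hz) as [H1 H2]. split; [|exact H2].
  now apply (is_Cderive_ext_disk F).
Qed.

Lemma C1_holomorphic_scal (c : C) (F F' : C -> C) :
  C1_holomorphic F F' -> C1_holomorphic (fun z => c * F z)%C (fun z => c * F' z)%C.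
Proof.
  intros HF z Hz. destruct (HF z Hz) as [H1 H2]. split.
  - now apply is_Cderive_scal.
  - apply Ccontinuous_mult; [apply Ccontinuous_const | exact H2].
Qed.

Lemma analytic_is_Cderive (h : C -> C) (z : C) :
  analytic_in_disk h -> in_disk z -> is_Cderive h z (C_derive h z).
Proof.
  intros Hh Hz. apply is_Cderive_C_NormedModule, C_derive_correct; [exact (RtoC 0)|].
  now apply Hh.
Qed.

Lemma is_Cderive_lin (h g : C -> C) (c z : C) :
  is_Cderive h z (C_derive h z) -> is_Cderive g z (C_derive g z) ->
  is_Cderive (fun w => h w + c * g w)%C z (C_derive h z + c * C_derive g z)%C.
Proof.
  intros H G. apply is_Cderive_plus; [exact H | now apply is_Cderive_scal].
Qed.

Lemma analytic_lin (h g : C -> C) (c : C) :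
  analytic_in_disk h -> analytic_in_disk g ->
  analytic_in_disk (fun w => h w + c * g w)%C.
Proof.
  intros H G z Hz. eexists. apply is_Cderive_C_NormedModule, is_Cderive_lin;
  now apply analytic_is_Cderive.
Qed.

(** Since [f = h + conj g], [Re f] is the real part of [h + g] and [Im f] is the real
part of [-i (h - g)]. *)
Lemma C1_holomorphic_derivatives (f h g : C -> C) :
  harmonic_in_disk f -> canonical_representation f h g ->
  exists h2 g2, C1_holomorphic (C_derive h) h2 /\ C1_holomorphic (C_derive g) g2.
Proof.
  intros [Hre Him] (Hh & Hg & _ & Hf).
  destruct (C1_holomorphic_derive_of_harmonic_re (fun z => h z + RtoC 1 * g z)%C
    (fun x y => fst (f (x, y)))) as [A2 HA].
  - now apply analytic_lin.
  - exact Hre.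
  - intros x y Hz. rewrite Hf by exact Hz. simpl. ring.
  - destruct (C1_holomorphic_derive_of_harmonic_re
      (fun z => (- Ci) * h z + Ci * g z)%C (fun x y => snd (f (x, y)))) as [B2 HB].
    + apply (analytic_lin (fun z => - Ci * h z)%C); [|exact Hg].
      intros z Hz. eexists. apply is_Cderive_C_NormedModule, is_Cderive_scal.
      now apply analytic_is_Cderive.
    + exact Him.
    + intros x y Hz. rewrite Hf by exact Hz. simpl. ring.
    + assert (EA : forall z, in_disk z ->
        C_derive (fun z => h z + RtoC 1 * g z)%C z = (C_derive h z + C_derive g z)%C).
      { intros z Hz. rewrite <- (Cmult_1_l (C_derive g z)).
        apply is_Cderive_unique, is_Cderive_lin; now apply analytic_is_Cderive. }
      assert (EB : forall z, in_disk z ->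
        C_derive (fun z => (- Ci) * h z + Ci * g z)%C z
        = (- Ci * C_derive h z + Ci * C_derive g z)%C).
      { intros z Hz. apply is_Cderive_unique, is_Cderive_plus;
        apply is_Cderive_scal; now apply analytic_is_Cderive. }
      assert (Ei : (Ci * Ci)%C = RtoC (-1)).
      { apply injective_projections; simpl; ring. }
      assert (E2 : forall w, (/ 2 * (w + w) = w)%C) by (intros w; field).
      (* With A = h + g and B = -i (h - g): h = (A + i B) / 2, g = (A - i B) / 2. *)
      eexists. eexists. split.
      * refine (C1_holomorphic_ext _ _ _ _
          (C1_holomorphic_scal (/ RtoC 2) _ _
             (C1_holomorphic_lin _ _ _ _ Ci HA HB))).
        intros z Hz. rewrite EA, EB by exact Hz. rewrite <- (E2 (C_derive h z)) at 3.
        f_equal.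
        transitivity (C_derive h z + C_derive g z - (Ci * Ci) * C_derive h z
          + (Ci * Ci) * C_derive g z)%C; [ring|].
        rewrite Ei. ring.
      * refine (C1_holomorphic_ext _ _ _ _
          (C1_holomorphic_scal (/ RtoC 2) _ _
             (C1_holomorphic_lin _ _ _ _ (- Ci)%C HA HB))).
        intros z Hz. rewrite EA, EB by exact Hz. rewrite <- (E2 (C_derive g z)) at 3.
        f_equal.
        transitivity (C_derive h z + C_derive g z + (Ci * Ci) * C_derive h z
          - (Ci * Ci) * C_derive g z)%C; [ring|].
        rewrite Ei. ring.
Qed.

(** * Comparison of the pre-Schwarzian norms *)

(** The difference on the left is
[(G' H - G H') / J * (e conj H + conj G) / (H + e G)], and the last factor has
modulus at most 1 by [Cmod_sq_shear]. *)
Lemma pre_schwarzian_difference (e H H' G G' : C) :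
  in_closed_disk e -> Cmod G < Cmod H ->
  Cmod ((H' + e * G') / (H + e * G)
        - (H' * Cconj H - G' * Cconj G) / RtoC (Cmod H ^ 2 - Cmod G ^ 2))%C
  <= Cmod (G' * H - G * H')%C / (Cmod H ^ 2 - Cmod G ^ 2).
Proof.
  intros He HGH.
  assert (HJ : 0 < Cmod H ^ 2 - Cmod G ^ 2).
  { assert (E2 := Cmod_ge_0 G). nra. }
  assert (HJ0 : RtoC (Cmod H ^ 2 - Cmod G ^ 2) <> RtoC 0).
  { intros E. apply RtoC_inj in E. lra. }
  assert (Hs : 0 < Cmod (H + e * G)%C).
  { assert (E := Cmod_triangle (H + e * G)%C (- (e * G))%C).
    replace (H + e * G + - (e * G))%C with H in E by ring.
    rewrite Cmod_opp, Cmod_mult in E.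
    assert (E2 := Cmod_ge_0 G). unfold in_closed_disk in He. nra. }
  assert (Hs0 := Cmod_pos_neq_0 _ Hs).
  replace (_ - _)%C with ((G' * H - G * H') / RtoC (Cmod H ^ 2 - Cmod G ^ 2)
    * ((e * Cconj H + Cconj G) / (H + e * G)))%C.
  2:{ assert (EJ : RtoC (Cmod H ^ 2 - Cmod G ^ 2) = (H * Cconj H - G * Cconj G)%C)
        by (now rewrite RtoC_minus, !Cmod2_conj).
      rewrite EJ in *. field. now split. }
  rewrite Cmod_mult, !Cmod_div, Cmod_R, (Rabs_pos_eq (_ - _)) by (trivial; lra).
  rewrite <- (Rmult_1_r (Cmod (G' * H - G * H')%C / _)) at 2.
  apply Rmult_le_compat_l.
  - apply Rdiv_le_0_compat; [apply Cmod_ge_0 | exact HJ].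
  - apply Rle_div_l; [exact Hs|]. rewrite Rmult_1_l.
    apply Cmod_le_of_sq. rewrite Cmod_sq_shear.
    apply Rmult_le_pos; [now apply one_minus_sq_nonneg | lra].
Qed.

Definition hyperbolic_density (P : C -> C) (z : C) : R :=
  (1 - Cmod z ^ 2) * Cmod (P z).

Lemma hyperbolic_density_gap (P Q : C -> C) (z : C) :
  in_disk z -> (1 - Cmod z ^ 2) * Cmod (P z - Q z) <= 1 ->
  Rabs (hyperbolic_density P z - hyperbolic_density Q z) <= 1.
Proof.
  intros Hz H. unfold hyperbolic_density. assert (H1 := one_minus_sq_pos z Hz).
  assert (T1 := Cmod_triangle (Q z) (P z - Q z)%C).
  replace (Q z + (P z - Q z))%C with (P z) in T1 by ring.
  assert (T2 := Cmod_triangle (P z) (- (P z - Q z))%C).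
  replace (P z + - (P z - Q z))%C with (Q z) in T2 by ring.
  rewrite Cmod_opp in T2.
  apply Rabs_le. nra.
Qed.

Lemma C_derive_lin (h g : C -> C) (c z : C) :
  analytic_in_disk h -> analytic_in_disk g -> in_disk z ->
  C_derive (fun w => h w + c * g w)%C z = (C_derive h z + c * C_derive g z)%C.
Proof.
  intros Hh Hg Hz. apply is_Cderive_unique, is_Cderive_lin;
    now apply analytic_is_Cderive.
Qed.

Lemma pre_schwarzian_gap (f h g : C -> C) (e z : C) :
  sense_preserving_harmonic f h g -> in_closed_disk e -> in_disk z ->
  Rabs (hyperbolic_density (pre_schwarzian_analytic (shear e h g)) z
        - hyperbolic_density (pre_schwarzian_harmonic h g) z) <= 1.
Proof.
  intros (Hf & Hc & HJ) He Hz. apply hyperbolic_density_gap; [exact Hz|].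
  destruct (C1_holomorphic_derivatives f h g Hf Hc) as (h2 & g2 & Hh2 & Hg2).
  destruct Hc as (Hh & Hg & _ & _).
  assert (E1 : forall w, in_disk w ->
    (C_derive h w + e * C_derive g w)%C = C_derive (shear e h g) w).
  { intros w Hw. symmetry. now apply C_derive_lin. }
  assert (E2 : C_derive (C_derive (shear e h g)) z = (h2 z + e * g2 z)%C).
  { apply is_Cderive_unique. apply (is_Cderive_ext_disk _ _ _ _ Hz E1).
    apply (C1_holomorphic_lin _ _ _ _ e Hh2 Hg2 z Hz). }
  assert (E3 : C_derive (C_derive h) z = h2 z) by (apply is_Cderive_unique, Hh2, Hz).
  assert (E4 : C_derive (C_derive g) z = g2 z) by (apply is_Cderive_unique, Hg2, Hz).
  unfold pre_schwarzian_analytic, pre_schwarzian_harmonic, jacobian.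
  rewrite E2, E3, E4, <- (E1 z Hz).
  assert (Hlt : forall w, in_disk w -> Cmod (C_derive g w) < Cmod (C_derive h w)).
  { intros w Hw. apply Cmod_lt_of_sq, (HJ w Hw). }
  assert (HD := pre_schwarzian_difference e _ (h2 z) _ (g2 z) He (Hlt z Hz)).
  assert (HSP := Schwarz_Pick_quotient _ _ _ _ z Hh2 Hg2 Hlt Hz).
  assert (H1 := one_minus_sq_pos z Hz).
  specialize (HJ z Hz). unfold jacobian in HJ.
  eapply Rle_trans; [apply Rmult_le_compat_l; [lra | exact HD]|].
  unfold Rdiv. rewrite <- Rmult_assoc. apply Rle_div_l; [exact HJ|]. lra.
Qed.

Lemma hyperbolic_sup_upper (P : C -> C) (z : C) :
  in_disk z -> Rbar_le (Finite (hyperbolic_density P z)) (hyperbolic_sup P).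
Proof.
  intros Hz. apply (proj1 (Lub_Rbar_correct _)). now exists z.
Qed.

Lemma hyperbolic_sup_least (P : C -> C) (b : Rbar) :
  (forall z, in_disk z -> Rbar_le (Finite (hyperbolic_density P z)) b) ->
  Rbar_le (hyperbolic_sup P) b.
Proof.
  intros H. apply (proj2 (Lub_Rbar_correct _)). intros r (z & Hz & ->). now apply H.
Qed.

(** The disk is not empty. *)
Lemma hyperbolic_sup_not_m_infty (P : C -> C) : hyperbolic_sup P <> m_infty.
Proof.
  intros E. assert (H := hyperbolic_sup_upper P (RtoC 0)). rewrite E in H.
  apply H. unfold in_disk. rewrite Cmod_0. lra.
Qed.

Lemma hyperbolic_sup_le_plus_1 (P Q : C -> C) (q : R) :
  (forall z, in_disk z -> hyperbolic_density P z <= hyperbolic_density Q z + 1) ->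
  hyperbolic_sup Q = Finite q ->
  exists p, hyperbolic_sup P = Finite p /\ p <= q + 1.
Proof.
  intros H HQ.
  assert (HP : Rbar_le (hyperbolic_sup P) (Finite (q + 1))).
  { apply hyperbolic_sup_least. intros z Hz. simpl.
    assert (E := hyperbolic_sup_upper Q z Hz). rewrite HQ in E. simpl in E.
    specialize (H z Hz). lra. }
  assert (N := hyperbolic_sup_not_m_infty P).
  destruct (hyperbolic_sup P) as [p| |]; [|contradiction|contradiction].
  now exists p.
Qed.

(** A uniform bound on the difference of two functions passes to their suprema; if one
supremum is infinite, so is the other. *)
Lemma hyperbolic_sup_gap (P Q : C -> C) :
  (forall z, in_disk z ->
     Rabs (hyperbolic_density P z - hyperbolic_density Q z) <= 1) ->
  (hyperbolic_sup P = p_infty /\ hyperbolic_sup Q = p_infty) \/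
  exists p q, hyperbolic_sup P = Finite p /\ hyperbolic_sup Q = Finite q /\
    Rabs (p - q) <= 1.
Proof.
  intros H.
  assert (H1 : forall z, in_disk z ->
    hyperbolic_density P z <= hyperbolic_density Q z + 1)
    by (intros z Hz; specialize (H z Hz); apply Rabs_le_between in H; lra).
  assert (H2 : forall z, in_disk z ->
    hyperbolic_density Q z <= hyperbolic_density P z + 1)
    by (intros z Hz; specialize (H z Hz); apply Rabs_le_between in H; lra).
  assert (NP := hyperbolic_sup_not_m_infty P).
  assert (NQ := hyperbolic_sup_not_m_infty Q).
  destruct (hyperbolic_sup Q) as [q| |] eqn:EQ; [| |contradiction].
  - destruct (hyperbolic_sup_le_plus_1 P Q q H1 EQ) as (p & EP & Hp).
    destruct (hyperbolic_sup_le_plus_1 Q P p H2 EP) as (q' & EQ' & Hq).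
    rewrite EQ in EQ'. injection EQ' as <-.
    right. exists p, q. repeat split; trivial. apply Rabs_le. lra.
  - left. split; [|trivial].
    destruct (hyperbolic_sup P) as [p| |] eqn:EP; [|trivial|contradiction].
    destruct (hyperbolic_sup_le_plus_1 Q P p H2 EP) as (q' & EQ' & _). congruence.
Qed.

Lemma shear_0 (h g : C -> C) : shear (RtoC 0) h g = h.
Proof. apply functional_extensionality. intros z. unfold shear. ring. Qed.

Lemma norm_shear_gap (f h g : C -> C) (e : C) :
  sense_preserving_harmonic f h g -> in_closed_disk e ->
  (norm_analytic (shear e h g) = p_infty /\ norm_harmonic h g = p_infty) \/
  exists p q, norm_analytic (shear e h g) = Finite p /\
    norm_harmonic h g = Finite q /\ Rabs (p - q) <= 1.
Proof.
  intros Hf He. apply hyperbolic_sup_gap. intros z Hz.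
  now apply (pre_schwarzian_gap f).
Qed.

Lemma in_closed_disk_0 : in_closed_disk (RtoC 0).
Proof. unfold in_closed_disk. rewrite Cmod_0. lra. Qed.

Lemma Rbar_gap_norm_shear_le_1 (f h g : C -> C) (e : C) :
  sense_preserving_harmonic f h g -> in_closed_disk e ->
  Rbar_lt (norm_harmonic h g) p_infty ->
  Rbar_le (Rbar_gap (norm_analytic (shear e h g)) (norm_harmonic h g)) (Finite 1).
Proof.
  intros Hf He Hfin.
  destruct (norm_shear_gap f h g e Hf He) as [[_ E] | (p & q & -> & -> & H)].
  - rewrite E in Hfin. contradiction.
  - exact H.
Qed.

(** * Extremal mappings *)

(** A class closed under partial differentiation, which makes membership in C^n provable
by induction on n. *)
Definition quadratic (c p q r s t x y : R) : R :=
  c + p * x + q * y + r * x ^ 2 + s * (x * y) + t * y ^ 2.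

Lemma quadratic_derive_fst (c p q r s t x y : R) :
  is_derive (fun u => quadratic c p q r s t u y) x (quadratic p (2 * r) s 0 0 0 x y).
Proof. unfold quadratic. auto_derive; [trivial | ring]. Qed.

Lemma quadratic_derive_snd (c p q r s t x y : R) :
  is_derive (fun v => quadratic c p q r s t x v) y (quadratic q s (2 * t) 0 0 0 x y).
Proof. unfold quadratic. auto_derive; [trivial | ring]. Qed.

Lemma continuity_2d_pt_quadratic (c p q r s t x y : R) :
  continuity_2d_pt (quadratic c p q r s t) x y.
Proof.
  unfold quadratic.
  repeat first [apply continuity_2d_pt_plus | apply continuity_2d_pt_mult
    | apply continuity_2d_pt_const | apply continuity_2d_pt_id1
    | apply continuity_2d_pt_id2].
Qed.

Lemma ex_diff_n_quadratic (n : nat) (c p q r s t x y : R) :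
  ex_diff_n (quadratic c p q r s t) n x y.
Proof.
  revert c p q r s t x y. induction n as [|n IH]; intros c p q r s t x y;
    assert (Hc := continuity_2d_pt_quadratic c p q r s t x y).
  - now split.
  - simpl. split; [exact Hc|]. split; [|split; [|split]].
    + eexists; apply quadratic_derive_fst.
    + eexists; apply quadratic_derive_snd.
    + apply (ex_diff_n_ext_loc (quadratic p (2 * r) s 0 0 0)); [|apply IH].
      exists (mkposreal 1 Rlt_0_1). intros u v _ _.
      symmetry. apply is_derive_unique, quadratic_derive_fst.
    + apply (ex_diff_n_ext_loc (quadratic q s (2 * t) 0 0 0)); [|apply IH].
      exists (mkposreal 1 Rlt_0_1). intros u v _ _.
      symmetry. apply is_derive_unique, quadratic_derive_snd.
Qed.

(** The Laplacian of a quadratic polynomial is twice the sum of its [x^2] and [y^2]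
coefficients. *)
Lemma harmonic_real_quadratic (u : R -> R -> R) (c p q r s : R) :
  (forall x y, u x y = quadratic c p q r s (- r) x y) -> harmonic_real u.
Proof.
  intros Hu.
  assert (E : u = quadratic c p q r s (- r)) by
    (apply functional_extensionality; intros x;
     apply functional_extensionality; apply Hu).
  rewrite E. intros x y _. split; [apply ex_diff_n_quadratic|].
  unfold partial_derive; simpl.
  rewrite (Derive_ext (fun x0 => Derive _ x0)
    (fun x0 => quadratic p (2 * r) s 0 0 0 x0 y))
    by (intros x0; apply is_derive_unique, quadratic_derive_fst).
  rewrite (Derive_ext (fun y0 => Derive _ y0)
    (fun y0 => quadratic q s (2 * - r) 0 0 0 x y0))
    by (intros y0; apply is_derive_unique, quadratic_derive_snd).
  rewrite (is_derive_unique _ _ _ (quadratic_derive_fst _ _ _ _ _ _ _ _)).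
  rewrite (is_derive_unique _ _ _ (quadratic_derive_snd _ _ _ _ _ _ _ _)).
  unfold quadratic. ring.
Qed.

(** With [extremal_g], chosen so that the dilatation is the disk automorphism
[(z - conj d) / (1 - d z)] and both derivatives are polynomials. *)
Definition extremal_h (d z : C) : C := (z - d * (RtoC (1 / 2) * (z * z)))%C.
Definition extremal_g (d z : C) : C := (RtoC (1 / 2) * (z * z) - Cconj d * z)%C.
Definition extremal_f (d z : C) : C := (extremal_h d z + Cconj (extremal_g d z))%C.

Lemma is_Cderive_half_sq (z : C) : is_Cderive (fun w => RtoC (1 / 2) * (w * w))%C z z.
Proof.
  apply is_Cderive_eps. intros eps. exists eps. intros w Hw.
  replace (RtoC (1 / 2) * (w * w) - RtoC (1 / 2) * (z * z) - (w - z) * z)%C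
    with (RtoC (1 / 2) * ((w - z) * (w - z)))%C.
  - rewrite !Cmod_mult, Cmod_R, Rabs_pos_eq by lra.
    assert (E := Cmod_ge_0 (w - z)%C). nra.
  - apply injective_projections; simpl; field.
Qed.

Lemma is_Cderive_extremal_h (d z : C) :
  is_Cderive (extremal_h d) z (RtoC 1 - d * z)%C.
Proof.
  apply (is_Cderive_minus (fun w => w)); [apply is_Cderive_id|].
  apply is_Cderive_scal, is_Cderive_half_sq.
Qed.

Lemma is_Cderive_extremal_g (d z : C) :
  is_Cderive (extremal_g d) z (z - Cconj d)%C.
Proof.
  apply is_Cderive_minus; [apply is_Cderive_half_sq|].
  apply (is_Cderive_ext_loc (fun w => RtoC 0 + Cconj d * w)%C _ _ _ 1); [lra| |].
  - intros w _. ring.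
  - apply is_Cderive_affine.
Qed.

Lemma C_derive_extremal_h (d : C) :
  C_derive (extremal_h d) = fun z => (RtoC 1 - d * z)%C.
Proof.
  apply functional_extensionality. intros z.
  apply is_Cderive_unique, is_Cderive_extremal_h.
Qed.

Lemma C_derive_extremal_g (d : C) :
  C_derive (extremal_g d) = fun z => (z - Cconj d)%C.
Proof.
  apply functional_extensionality. intros z.
  apply is_Cderive_unique, is_Cderive_extremal_g.
Qed.

Lemma C_derive_affine (F : C -> C) (c0 c1 z : C) :
  (forall w, F w = c0 + c1 * w)%C -> C_derive F z = c1.
Proof.
  intros HF. apply is_Cderive_unique.
  apply (is_Cderive_ext_loc (fun w => c0 + c1 * w)%C _ _ _ 1); [lra| |].
  - intros w _. now rewrite HF.
  - apply is_Cderive_affine.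
Qed.

Lemma jacobian_extremal (d z : C) :
  jacobian (extremal_h d) (extremal_g d) z = (1 - Cmod d ^ 2) * (1 - Cmod z ^ 2).
Proof.
  unfold jacobian. rewrite C_derive_extremal_h, C_derive_extremal_g.
  rewrite !Cmod2_alt. destruct d, z; simpl. ring.
Qed.

Lemma sense_preserving_extremal (d : C) :
  in_disk d -> sense_preserving_harmonic (extremal_f d) (extremal_h d) (extremal_g d).
Proof.
  intros Hd. split; [|split].
  - destruct d as [a b]. split.
    + apply (harmonic_real_quadratic _ 0 (1 - a) (- b) ((1 - a) / 2) b).
      intros x y. unfold quadratic. simpl. field.
    + apply (harmonic_real_quadratic _ 0 (- b) (1 + a) (- b / 2) (- (1 + a))).
      intros x y. unfold quadratic. simpl. field.
  - split; [|split; [|split]].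
    + intros z _. eexists. apply is_Cderive_C_NormedModule, is_Cderive_extremal_h.
    + intros z _. eexists. apply is_Cderive_C_NormedModule, is_Cderive_extremal_g.
    + unfold extremal_g. ring.
    + reflexivity.
  - intros z Hz. rewrite jacobian_extremal.
    apply one_minus_sq_pos in Hd, Hz. now apply Rmult_lt_0_compat.
Qed.

Lemma hyperbolic_sup_eq (P : C -> C) (l : R) :
  (forall z, in_disk z -> hyperbolic_density P z <= l) ->
  (forall b, b < l -> exists z, in_disk z /\ b < hyperbolic_density P z) ->
  hyperbolic_sup P = Finite l.
Proof.
  intros Hub Hlub. apply is_lub_Rbar_unique. split.
  - intros r (z & Hz & ->). now apply Hub.
  - intros b Hb. destruct b as [b| |]; simpl.
    + apply Rnot_lt_le. intros Hbl. destruct (Hlub b Hbl) as (z & Hz & Hbz).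
      assert (E : Rbar_le (Finite (hyperbolic_density P z)) (Finite b))
        by (apply Hb; now exists z).
      simpl in E. lra.
    + trivial.
    + destruct (Hlub (l - 1)) as (z & Hz & _); [lra|].
      apply (Hb (hyperbolic_density P z)). now exists z.
Qed.

(** Here [P_f = - conj z / (1 - |z|^2)], whatever [d] is. *)
Lemma norm_harmonic_extremal (d : C) :
  in_disk d -> norm_harmonic (extremal_h d) (extremal_g d) = Finite 1.
Proof.
  intros Hd. assert (Hd1 := one_minus_sq_pos d Hd).
  assert (E : forall z, in_disk z -> hyperbolic_density
    (pre_schwarzian_harmonic (extremal_h d) (extremal_g d)) z = Cmod z).
  { intros z Hz. assert (Hz1 := one_minus_sq_pos z Hz).
    unfold hyperbolic_density, pre_schwarzian_harmonic.
    rewrite jacobian_extremal.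
    rewrite (C_derive_affine (C_derive (extremal_h d)) (RtoC 1) (- d)%C).
    2:{ intros w. rewrite C_derive_extremal_h. ring. }
    rewrite (C_derive_affine (C_derive (extremal_g d)) (- Cconj d)%C (RtoC 1)).
    2:{ intros w. rewrite C_derive_extremal_g. ring. }
    rewrite C_derive_extremal_h, C_derive_extremal_g.
    replace (- d * Cconj (RtoC 1 - d * z) - RtoC 1 * Cconj (z - Cconj d))%C
      with (RtoC (- (1 - Cmod d ^ 2)) * Cconj z)%C.
    2:{ rewrite Cmod2_alt. destruct d, z; apply injective_projections; simpl; ring. }
    assert (HJ : 0 < (1 - Cmod d ^ 2) * (1 - Cmod z ^ 2))
      by now apply Rmult_lt_0_compat.
    rewrite Cmod_div, Cmod_mult, Cmod_conj, !Cmod_R, Rabs_Ropp, !Rabs_pos_eq by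
      (try (intros E; apply RtoC_inj in E); lra).
    field. lra. }
  apply hyperbolic_sup_eq.
  - intros z Hz. rewrite E by exact Hz. now apply Rlt_le.
  - intros b Hb. exists (RtoC (Rmax 0 ((1 + b) / 2))).
    assert (H0 := Rmax_l 0 ((1 + b) / 2)). assert (H1 := Rmax_r 0 ((1 + b) / 2)).
    assert (H2 : Rmax 0 ((1 + b) / 2) < 1) by (apply Rmax_lub_lt; lra).
    assert (Hz : in_disk (RtoC (Rmax 0 ((1 + b) / 2))))
      by (unfold in_disk; now rewrite Cmod_R, Rabs_pos_eq).
    split; [exact Hz|]. rewrite E, Cmod_R, Rabs_pos_eq by assumption. lra.
Qed.

Lemma C_derive_shear_extremal (d e z : C) :
  C_derive (shear e (extremal_h d) (extremal_g d)) z
  = ((RtoC 1 - e * Cconj d) + (e - d) * z)%C.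
Proof.
  apply is_Cderive_unique.
  replace ((RtoC 1 - e * Cconj d) + (e - d) * z)%C
    with (RtoC 1 - d * z + e * (z - Cconj d))%C by ring.
  apply is_Cderive_plus; [apply is_Cderive_extremal_h|].
  apply is_Cderive_scal, is_Cderive_extremal_g.
Qed.

Lemma hyperbolic_density_shear_extremal (d e z : C) :
  hyperbolic_density
    (pre_schwarzian_analytic (shear e (extremal_h d) (extremal_g d))) z
  = (1 - Cmod z ^ 2)
    * Cmod ((e - d) / ((RtoC 1 - e * Cconj d) + (e - d) * z))%C.
Proof.
  unfold hyperbolic_density, pre_schwarzian_analytic.
  now rewrite (C_derive_affine _ _ _ z (C_derive_shear_extremal d e)),
    C_derive_shear_extremal.
Qed.

(** The shear [h + e g] is affine, as its derivative is [1 - |e|^2]. *)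
Lemma norm_analytic_shear_extremal_interior (e : C) :
  norm_analytic (shear e (extremal_h e) (extremal_g e)) = Finite 0.
Proof.
  assert (E : forall z, hyperbolic_density
    (pre_schwarzian_analytic (shear e (extremal_h e) (extremal_g e))) z = 0).
  { intros z. rewrite hyperbolic_density_shear_extremal.
    unfold Cdiv. replace (e - e)%C with (RtoC 0) by ring.
    rewrite Cmult_0_l, Cmod_0. ring. }
  apply hyperbolic_sup_eq.
  - intros z _. rewrite E. lra.
  - intros b Hb. exists (RtoC 0). rewrite E. split; [|exact Hb].
    unfold in_disk. rewrite Cmod_0. lra.
Qed.

(** The density is [(1 - |z|^2) / |1 + e z| <= 1 + |z|], with equality on the radius
where [e z] is negative. *)
Lemma norm_analytic_shear_extremal_boundary (e : C) :
  Cmod e = 1 ->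
  norm_analytic (shear e (extremal_h (RtoC 0)) (extremal_g (RtoC 0))) = Finite 2.
Proof.
  intros He.
  assert (E : forall z, in_disk z -> 0 < Cmod (RtoC 1 + e * z)%C /\ hyperbolic_density
    (pre_schwarzian_analytic (shear e (extremal_h (RtoC 0)) (extremal_g (RtoC 0)))) z
    = (1 - Cmod z ^ 2) / Cmod (RtoC 1 + e * z)%C /\
    1 - Cmod z <= Cmod (RtoC 1 + e * z)%C).
  { intros z Hz. unfold in_disk in Hz.
    assert (T := Cmod_triangle (RtoC 1 + e * z)%C (- (e * z))%C).
    replace (RtoC 1 + e * z + - (e * z))%C with (RtoC 1) in T by ring.
    rewrite Cmod_opp, Cmod_mult, He, Cmod_1 in T.
    assert (Hp : 0 < Cmod (RtoC 1 + e * z)%C) by lra.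
    split; [exact Hp | split; [|lra]].
    rewrite hyperbolic_density_shear_extremal.
    replace (Cconj (RtoC 0)) with (RtoC 0) by
      (apply injective_projections; simpl; ring).
    replace (RtoC 1 - e * RtoC 0 + (e - RtoC 0) * z)%C with (RtoC 1 + e * z)%C by ring.
    replace (e - RtoC 0)%C with e by ring.
    rewrite Cmod_div, He by now apply Cmod_pos_neq_0. field. lra. }
  apply hyperbolic_sup_eq.
  - intros z Hz. destruct (E z Hz) as (Hp & -> & Hr).
    apply Rle_div_l; [exact Hp|]. unfold in_disk in Hz.
    assert (Hz0 := Cmod_ge_0 z). nra.
  (* [1 + r > b] as soon as [r >= b / 2], because [b < 2]. *)
  - intros b Hb. set (r := Rmax 0 (b / 2)).
    assert (H0 : 0 <= r) by apply Rmax_l. assert (H1 : b / 2 <= r) by apply Rmax_r.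
    assert (H2 : r < 1) by (apply Rmax_lub_lt; lra).
    assert (Hm : Cmod (RtoC (- r) * Cconj e)%C = r)
      by (rewrite Cmod_mult, Cmod_conj, He, Cmod_R, Rabs_Ropp, Rabs_pos_eq; lra).
    assert (Hz : in_disk (RtoC (- r) * Cconj e)%C) by (unfold in_disk; now rewrite Hm).
    exists (RtoC (- r) * Cconj e)%C. split; [exact Hz|].
    destruct (E _ Hz) as (_ & -> & _). rewrite Hm.
    replace (RtoC 1 + e * (RtoC (- r) * Cconj e))%C with (RtoC (1 - r)).
    + rewrite Cmod_R, Rabs_pos_eq by lra.
      replace ((1 - r ^ 2) / (1 - r)) with (1 + r) by (field; lra). lra.
    + transitivity (RtoC 1 + RtoC (- r) * (e * Cconj e))%C; [|ring].
      rewrite <- Cmod2_conj, He, <- RtoC_mult, <- RtoC_plus. f_equal. ring.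
Qed.

Lemma exists_gap_one (e : C) :
  in_closed_disk e ->
  exists f h g, sense_preserving_harmonic f h g /\
    norm_harmonic h g = Finite 1 /\
    (norm_analytic (shear e h g) = Finite 0 \/ norm_analytic (shear e h g) = Finite 2).
Proof.
  intros He. unfold in_closed_disk in He.
  destruct (Rle_lt_or_eq_dec _ _ He) as [Hlt | Heq].
  - exists (extremal_f e), (extremal_h e), (extremal_g e).
    split; [now apply sense_preserving_extremal|].
    split; [now apply norm_harmonic_extremal|].
    left. apply norm_analytic_shear_extremal_interior.
  - assert (H0 : in_disk (RtoC 0)) by (unfold in_disk; rewrite Cmod_0; lra).
    exists (extremal_f (RtoC 0)), (extremal_h (RtoC 0)), (extremal_g (RtoC 0)).
    split; [now apply sense_preserving_extremal|].
    split; [now apply norm_harmonic_extremal|].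
    right. now apply norm_analytic_shear_extremal_boundary.
Qed.

Lemma one_le_admissible_constant (e : C) (c : R) :
  in_closed_disk e ->
  (forall f h g : C -> C, sense_preserving_harmonic f h g ->
     Rbar_lt (norm_harmonic h g) p_infty ->
     Rbar_le (Rbar_gap (norm_analytic (shear e h g)) (norm_harmonic h g)) (Finite c)) ->
  1 <= c.
Proof.
  intros He H. destruct (exists_gap_one e He) as (f & h & g & Hf & Hn & Hs).
  specialize (H f h g Hf). rewrite Hn in H. specialize (H I).
  destruct Hs as [-> | ->] in H; simpl in H; unfold Rabs in H;
    destruct Rcase_abs in H; lra.
Qed.

Theorem theorem2p1 :
  (forall f h g : C -> C, sense_preserving_harmonic f h g ->
     (forall eps : C, in_closed_disk eps ->
        (norm_analytic (shear eps h g) = p_infty /\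
         norm_harmonic h g = p_infty) \/
        (is_finite (norm_analytic (shear eps h g)) /\
         is_finite (norm_harmonic h g))) /\
     (Rbar_lt (norm_harmonic h g) p_infty ->
        (forall eps : C, in_closed_disk eps ->
           Rbar_le
             (Rbar_gap (norm_analytic (shear eps h g)) (norm_harmonic h g))
             (Finite 1)) /\
        Rbar_le (Rbar_gap (norm_analytic h) (norm_harmonic h g)) (Finite 1))) /\
  (* sharpness, for each eps: no constant smaller than 1 is admissible *)
  (forall eps : C, in_closed_disk eps ->
     forall c : R,
       (forall f h g : C -> C, sense_preserving_harmonic f h g ->
          Rbar_lt (norm_harmonic h g) p_infty ->
          Rbar_le
            (Rbar_gap (norm_analytic (shear eps h g)) (norm_harmonic h g))
            (Finite c)) ->
       1 <= c) /\
  (forall c : R,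
     (forall f h g : C -> C, sense_preserving_harmonic f h g ->
        Rbar_lt (norm_harmonic h g) p_infty ->
        Rbar_le (Rbar_gap (norm_analytic h) (norm_harmonic h g)) (Finite c)) ->
     1 <= c).
Proof.
  split; [|split].
  - intros f h g Hf. split.
    + intros eps He.
      destruct (norm_shear_gap f h g eps Hf He) as [H | (p & q & -> & -> & _)];
        [now left | now right].
    + intros Hfin. split.
      * intros eps He. now apply (Rbar_gap_norm_shear_le_1 f).
      * rewrite <- (shear_0 h g) at 1.
        now apply (Rbar_gap_norm_shear_le_1 f); [|apply in_closed_disk_0|].
  - intros eps He c. now apply one_le_admissible_constant.
  - intros c H. apply (one_le_admissible_constant (RtoC 0) c in_closed_disk_0).
    intros f h g Hf Hfin. rewrite shear_0. now apply (H f).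
Qed.
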